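(* If $A$ is a finitely generated (associative unital) $\mathbb C$-algebra, then its Arens-Michael envelope $\widehat A$ is holomorphically finitely generated.
   Context: All algebras are associative unital $\mathbb C$-algebras and all homomorphisms are unital. A locally $m$-convex algebra is a topological algebra whose topology is defined by a family of submultiplicative seminorms; an Arens-Michael algebra is a complete (Hausdorff) locally $m$-convex algebra; a Fréchet-Arens-Michael algebra is one whose underlying space is Fréchet. The Arens-Michael envelope of an algebra $A$ is a pair $(\widehat A,i_A)$ consisting of an Arens-Michael algebra $\widehat A$ and a homomorphism $i_A:A\to\widehat A$ such that for each Arens-Michael algebra $B$ and each homomorphism $\varphi:A\to B$ there is a unique continuous homomorphism $\widehat\varphi:\widehat A\to B$ with $\widehat\varphi\circ i_A=\varphi$. It always exists (it is the completion of $A$ with respect to the family of all submultiplicative seminorms on $A$) and is unique up to a unique topological isomorphism over $A$. Let $W_n=\bigsqcup_{k\ge 0}\{1,\dots,n\}^k$, and for $\alpha=(\alpha_1,\dots,\alpha_k)\in W_n$ put $|\alpha|=k$ and $\zeta_\alpha=\zeta_{\alpha_1}\cdots\zeta_{\alpha_k}$ ($\zeta_\emptyset=1$). The algebra of free entire functions is $$\mathcal F_n=\Bigl\{a=\sum_{\alpha\in W_n}c_\alpha\zeta_\alpha:\ \|a\|_\rho=\sum_{\alpha\in W_n}|c_\alpha|\rho^{|\alpha|}<\infty\ \ \forall\rho>0\Bigr\}$$ (formal series in the free noncommuting variables $\zeta_1,\dots,\zeta_n$), with the topology given by the seminorms $\|\cdot\|_\rho$ and concatenation product. For an Arens-Michael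 algebra $A$, $a\in A^n$ and $f=\sum_\alpha c_\alpha\zeta_\alpha\in\mathcal F_n$ put $f(a)=\sum_\alpha c_\alpha a_\alpha\in A$, where $a_\alpha=a_{\alpha_1}\cdots a_{\alpha_k}$ and $a_\emptyset=1$. A subalgebra $B$ of a Fréchet-Arens-Michael algebra $A$ is holomorphically closed if $f(b)\in B$ for all $n\in\mathbb N$, $b\in B^n$, $f\in\mathcal F_n$. $\mathrm{Hol}(S)$, for $S\subseteq A$, is the intersection of all holomorphically closed subalgebras of $A$ containing $S$. A Fréchet-Arens-Michael algebra $A$ is holomorphically finitely generated (HFG) if $\mathrm{Hol}(S)=A$ for some finite subset $S\subseteq A$; in particular an HFG algebra is by definition a Fréchet-Arens-Michael algebra. *)

(* Defs.v *)
From HB Require Import structures.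
From mathcomp Require Import all_boot all_order all_algebra finmap.
From mathcomp Require Import complex.
From mathcomp Require Import all_classical all_reals all_analysis.
From mathcomp Require summability.

Set Implicit Arguments.
Unset Strict Implicit.
Unset Printing Implicit Defensive.

Import Order.TTheory GRing.Theory Num.Theory.
Import numFieldNormedType.Exports.

Local Open Scope classical_set_scope.
Local Open Scope ring_scope.

(* MathComp's algType excludes the zero ring, which has to be allowed here: the
   Arens-Michael envelope of a nonzero algebra (e.g. of a Weyl algebra) may
   vanish.  Hierarchy-Builder also rejects a join of pzRingType and lmodType K
   below algType, hence a separate multiplication and unit on lmodType K. *)
HB.mixin Record Lmodule_isAssocAlgebra (K : pzRingType) A
    of GRing.Lmodule K A := {
  amul : A -> A -> A ;
  aone : A ;
  amulA : associative amul ;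
  amul1l : left_id aone amul ;
  amul1r : right_id aone amul ;
  amulDl : left_distributive amul +%R ;
  amulDr : right_distributive amul +%R ;
  amulZl : forall (a : K) (x y : A), amul (a *: x) y = a *: amul x y ;
  amulZr : forall (a : K) (x y : A), amul x (a *: y) = a *: amul x y
}.

#[short(type="assocAlgType")]
HB.structure Definition AssocAlgebra (K : pzRingType) :=
  {A of GRing.Lmodule K A & Lmodule_isAssocAlgebra K A}.

Notation "x ** y" := (amul x y) (at level 40, left associativity) : ring_scope.

HB.mixin Record AssocAlgebra_isTopologicalAlgebra (K : numDomainType) A
    of AssocAlgebra K A & TopologicalLmodule K A := {
  amul_continuous : continuous (fun x : A * A => x.1 ** x.2)
}.

#[short(type="topAlgType")]
HB.structure Definition TopologicalAlgebra (K : numDomainType) :=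
  {A of AssocAlgebra K A & TopologicalLmodule K A
        & AssocAlgebra_isTopologicalAlgebra K A}.

Section Algebras.
Context {K : pzRingType}.

Definition alg_hom (A B : assocAlgType K) (f : A -> B) : Prop :=
  [/\ linear f, f aone = aone & forall x y, f (x ** y) = f x ** f y].

Definition subalgebra (A : assocAlgType K) (B : set A) : Prop :=
  [/\ B aone,
      forall (a : K) (x y : A), B x -> B y -> B (a *: x + y)
    & forall x y : A, B x -> B y -> B (x ** y)].

Definition finitely_generated (A : assocAlgType K) : Prop :=
  exists2 S : set A, finite_set S & smallest (@subalgebra A) S = [set: A].

End Algebras.

Section LocallyConvex.
Context {R : realType}.
Local Notation C := R[i].

Definition seminorm (E : lmodType C) (p : E -> R) : Prop :=
  [/\ forall x, 0 <= p x,
      forall x y, p (x + y) <= p x + p y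
    & forall (a : C) x, p (a *: x) = ComplexField.Normc.normc a * p x].

Definition defines_topology (E : topologicalLmodType C) (P : set (E -> R))
    : Prop :=
  forall (x : E) (U : set E), nbhs x U <->
    exists F : set (E -> R), exists e : R,
      [/\ finite_set F, F `<=` P, 0 < e
        & [set y | forall p, F p -> p (y - x) < e] `<=` U].

(* Completeness for the uniformity of the additive topological group; filters
   rather than sequences, so that no metrizability is presupposed. *)
Definition cauchy_filter (E : topologicalLmodType C) (F : set_system E) : Prop :=
  (fun xy : E * E => xy.1 - xy.2) @ filter_prod F F --> (0 : E).

Definition complete_space (E : topologicalLmodType C) : Prop :=
  forall F : set_system E, ProperFilter F -> cauchy_filter F ->
    exists x : E, F --> x.

Definition frechet_space (E : topologicalLmodType C) : Prop :=
  [/\ hausdorff_space E, complete_space E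
    & exists p : nat -> E -> R,
        (forall k, seminorm (p k)) /\ defines_topology (range p)].

End LocallyConvex.

Section ArensMichael.
Context {R : realType}.
Local Notation C := R[i].

Definition submultiplicative (A : assocAlgType C) (p : A -> R) : Prop :=
  forall x y, p (x ** y) <= p x * p y.

Definition locally_m_convex (A : topAlgType C) : Prop :=
  exists P : set (A -> R),
    (forall p, P p -> seminorm p /\ submultiplicative p) /\ defines_topology P.

Definition arens_michael (A : topAlgType C) : Prop :=
  [/\ locally_m_convex A, hausdorff_space A & complete_space A].

Definition frechet_arens_michael (A : topAlgType C) : Prop :=
  arens_michael A /\ frechet_space A.

Definition arens_michael_envelope
    (A : assocAlgType C) (Ahat : topAlgType C) (iA : A -> Ahat) : Prop :=
  [/\ arens_michael Ahat, alg_hom iA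
    & forall (B : topAlgType C) (phi : A -> B),
        arens_michael B -> alg_hom phi ->
        exists! psi : Ahat -> B,
          [/\ continuous psi, alg_hom psi & psi \o iA = phi]].

End ArensMichael.

Section HFG.
Context {R : realType}.
Local Notation C := R[i].

(* A word of W_n is a sequence over 'I_n, and a free entire function is given by
   its coefficients. *)
Record free_entire (n : nat) := FreeEntire {
  fe_coef :> seq 'I_n -> C ;
  fe_summable : forall rho : R, 0 < rho ->
    (\esum_(w in [set: seq 'I_n])
       (ComplexField.Normc.normc (fe_coef w) * rho ^+ size w)%:E < +oo)%E
}.

Definition word_eval (A : assocAlgType C) (n : nat) (a : 'I_n -> A)
    (w : seq 'I_n) : A :=
  foldr (fun i x => a i ** x) aone w.

(* f(a) is the sum of the family over W_n, i.e. the limit of its finite partial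
   sums along the directed set of finite subsets of W_n.  In an Arens-Michael
   algebra the family is absolutely summable, so the default value 0 is not
   used. *)
Definition free_eval (A : topAlgType C) (n : nat) (f : free_entire n)
    (a : 'I_n -> A) : A :=
  xget 0 [set s : A |
    summability.partial_sum (fun w => f w *: word_eval a w)
      @ summability.totally --> s].

Definition holomorphically_closed (A : topAlgType C) (B : set A) : Prop :=
  forall (n : nat) (b : 'I_n -> A) (f : free_entire n),
    (forall i, B (b i)) -> B (free_eval f b).

Definition Hol (A : topAlgType C) (S : set A) : set A :=
  smallest (fun B => subalgebra B /\ holomorphically_closed B) S.

Definition HFG (A : topAlgType C) : Prop :=
  frechet_arens_michael A /\
  exists2 S : set A, finite_set S & Hol S = [set: A].

End HFG.

(* Main.v *)
From HB Require Import structures.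
Require Import Defs.
From mathcomp Require Import all_boot all_order all_algebra finmap.
From mathcomp Require Import complex.
From mathcomp Require Import all_classical all_reals all_analysis.
From mathcomp Require summability.
Set Implicit Arguments.
Unset Strict Implicit.
Unset Printing Implicit Defensive.
Import Order.TTheory GRing.Theory Num.Theory.
Import numFieldNormedType.Exports.
Local Open Scope classical_set_scope.
Local Open Scope ring_scope.

(** Let [A] be generated by [s 0, ..., s (n-1)].  For each natural number [k],
    the infimum of [sum |c_w| k^|w|] over all ways of writing [a] as a finite sum
    [sum c_w s_w] is a submultiplicative seminorm [P k] on [A].  These seminorms
    increase with [k], and every submultiplicative seminorm [q] is at most a
    constant times one of them, since [q (s_w) <= q(1) k^|w|] once [k >= q (s_i)] for all [i]
    ([word_tower_dominates]).  So the topology of an Arens-Michael envelope should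
    be the one given by the countable family [P], and its elements should be sums
    of series [sum c_w s_w] that converge absolutely for every weight [k].

    The envelope is only known through its universal property, which says nothing
    until an Arens-Michael algebra to map into is at hand.  That algebra is the
    completion [C] of [A] for the seminorms [P k]: Cauchy sequences modulo null
    sequences ([completion_arens_michael]).  The universal property gives
    [psi : Ahat -> C] over [A]; conversely a homomorphism [A -> Ahat] is continuous
    for [P] by domination and extends to [theta : C -> Ahat] by taking limits.
    The composite [theta \o psi] is an endomorphism of [Ahat] over [A], hence the
    identity ([envelope_section]).  Thus [Ahat] is a retract of [C].

    Both halves of the conclusion follow.  The norms of [C] pulled back along [psi]
    are countably many seminorms that define the topology of [Ahat]
    ([retract_countable_seminorms]).  And each [x] in [Ahat] is [theta (psi x)],
    the limit of the images of a Cauchy sequence of [A]; writing the differences of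
    a rapidly converging subsequence as small word sums and adding up the
    coefficients word by word yields a free entire function whose value at the
    images of the generators is [x] ([free_eval_limit]).  So these images already
    generate [Ahat] holomorphically. *)

(** * Seminorms and algebra homomorphisms *)

Section ComplexModulus.
Context {R : realType}.
Local Notation normc := (@ComplexField.Normc.normc R).
Implicit Types z w : R[i].

Lemma normc_ge0 z : 0 <= normc z.
Proof. by case: z => a b; exact: sqrtr_ge0. Qed.

Lemma ler_normcD z w : normc (z + w) <= normc z + normc w.
Proof. exact: (@le_normcD R z w). Qed.

Lemma normrcE z : `|z| = (normc z)%:C%C.
Proof. by case: z. Qed.

Lemma normc_Re_Im z : normc z <= `|complex.Re z| + `|complex.Im z|.
Proof.
case: z => a b /=; rewrite -(ler_pXn2r (n := 2)) ?nnegrE ?sqrtr_ge0 ?addr_ge0//.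
rewrite sqr_sqrtr ?addr_ge0 ?sqr_ge0// sqrrD !real_normK ?num_real//.
by rewrite lerD2r lerDl mulrn_wge0// mulr_ge0.
Qed.

Lemma Re_le_normc z : `|complex.Re z| <= normc z.
Proof.
case: z => a b /=; rewrite -(ler_pXn2r (n := 2)) ?nnegrE ?sqrtr_ge0//.
by rewrite sqr_sqrtr ?addr_ge0 ?sqr_ge0// real_normK ?num_real// lerDl sqr_ge0.
Qed.

Lemma Im_le_normc z : `|complex.Im z| <= normc z.
Proof.
case: z => a b /=; rewrite -(ler_pXn2r (n := 2)) ?nnegrE ?sqrtr_ge0//.
by rewrite sqr_sqrtr ?addr_ge0 ?sqr_ge0// real_normK ?num_real// lerDr sqr_ge0.
Qed.

End ComplexModulus.

Section SeminormTheory.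
Context {R : realType} {E : lmodType R[i]} {p : E -> R}.
Hypothesis semip : seminorm p.
Local Notation normc := (@ComplexField.Normc.normc R).

Lemma seminorm_ge0 x : 0 <= p x. Proof. by case: semip. Qed.

Lemma seminormD x y : p (x + y) <= p x + p y. Proof. by case: semip. Qed.

Lemma seminormZ (a : R[i]) x : p (a *: x) = normc a * p x.
Proof. by case: semip. Qed.

Lemma seminorm0 : p 0 = 0.
Proof. by rewrite -[X in p X](scale0r 0) seminormZ Normc.normc0 mul0r. Qed.

Lemma seminormN x : p (- x) = p x.
Proof.
rewrite -scaleN1r seminormZ (_ : normc (-1) = 1) ?mul1r//=.
by rewrite oppr0 expr0n addr0 sqrrN expr1n sqrtr1.
Qed.

Lemma seminormBC x y : p (x - y) = p (y - x).
Proof. by rewrite -seminormN opprB. Qed.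

Lemma seminormB_trans y x z : p (x - z) <= p (x - y) + p (y - z).
Proof. by rewrite -[X in p X](subrKA y) seminormD. Qed.

Lemma seminorm_sum I (r : seq I) (Q : pred I) (F : I -> E) :
  p (\sum_(i <- r | Q i) F i) <= \sum_(i <- r | Q i) p (F i).
Proof.
elim/big_ind2: _ => [|x a y b xa yb|//]; first by rewrite seminorm0.
exact: le_trans (seminormD _ _) (lerD xa yb).
Qed.

Lemma seminorm_dist x y : `|p x - p y| <= p (x - y).
Proof.
rewrite ler_norml; apply/andP; split; last first.
  by rewrite lerBlDr -[in p x](subrK y x) seminormD.
rewrite lerNl opprB lerBlDr seminormBC -[X in p X <= _](subrK x y).
exact: seminormD.
Qed.

End SeminormTheory.

Section AlgebraTheory.
Context {K : pzRingType} {A : assocAlgType K}.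
Implicit Types x y z : A.

Lemma amul0l x : 0 ** x = 0.
Proof. by rewrite -[X in X ** _](scale0r 0) amulZl scale0r. Qed.

Lemma amul0r x : x ** 0 = 0.
Proof. by rewrite -[X in _ ** X](scale0r 0) amulZr scale0r. Qed.

Lemma amulBl x y z : (x - y) ** z = x ** z - y ** z.
Proof. by rewrite -!scaleN1r amulDl amulZl. Qed.

Lemma amulBr x y z : z ** (x - y) = z ** x - z ** y.
Proof. by rewrite -!scaleN1r amulDr amulZr. Qed.

End AlgebraTheory.

Section AlgebraHomomorphisms.
Context {K : pzRingType} {A B : assocAlgType K} {f : A -> B}.
Hypothesis f_hom : alg_hom f.

Lemma alg_homD x y : f (x + y) = f x + f y.
Proof. by case: f_hom => linf _ _; rewrite -[x in LHS]scale1r linf scale1r. Qed.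

Lemma alg_homB x y : f (x - y) = f x - f y.
Proof. by case: f_hom => linf _ _; rewrite addrC -scaleN1r linf scaleN1r addrC. Qed.

Lemma alg_hom0 : f 0 = 0.
Proof. by rewrite -(subrr 0) alg_homB subrr. Qed.

Lemma alg_homZ a x : f (a *: x) = a *: f x.
Proof. by case: f_hom => linf _ _; rewrite -[a *: x]addr0 linf alg_hom0 addr0. Qed.

Lemma alg_hom_comp (C : assocAlgType K) (g : B -> C) : alg_hom g -> alg_hom (g \o f).
Proof.
case: f_hom => linf f1 fM [ling g1 gM].
by split=> [a x y||x y] /=; rewrite ?linf ?ling ?f1 ?fM.
Qed.

End AlgebraHomomorphisms.

Section SeminormPullback.
Context {R : realType} {A B : assocAlgType R[i]} {f : A -> B} {p : B -> R}.
Hypothesis f_hom : alg_hom f.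

Lemma seminorm_comp : seminorm p -> seminorm (p \o f).
Proof.
move=> sp; split=> [x|x y|a x] /=; first exact: (seminorm_ge0 sp).
- by rewrite (alg_homD f_hom); exact: (seminormD sp).
- by rewrite (alg_homZ f_hom); exact: (seminormZ sp).
Qed.

Lemma submultiplicative_comp : submultiplicative p -> submultiplicative (p \o f).
Proof. by case: f_hom => _ _ fM mp x y /=; rewrite fM; exact: mp. Qed.

End SeminormPullback.

(** * Topologies defined by seminorms *)

Section TopologicalAlgebraLimits.
Context {K : numFieldType} {T : Type} {F : set_system T} {FF : Filter F}.

Lemma tlmod_cvgD (E : topologicalLmodType K) (f g : T -> E) (x y : E) :
  f @ F --> x -> g @ F --> y -> f t + g t @[t --> F] --> x + y.
Proof. exact: (continuous2_cvg _ (h := +%R) (@add_continuous E (x, y))). Qed.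

Lemma tlmod_cvgZ (E : topologicalLmodType K) (a : K) (f : T -> E) (x : E) :
  f @ F --> x -> a *: f t @[t --> F] --> a *: x.
Proof.
move=> fx; apply: (continuous2_cvg _ (h := fun (b : K^o) (y : E) => b *: y)
  (@scale_continuous _ E (a, x)) _ fx); exact: cvg_cst.
Qed.

Lemma topalg_cvgM (E : topAlgType K) (f g : T -> E) (x y : E) :
  f @ F --> x -> g @ F --> y -> f t ** g t @[t --> F] --> x ** y.
Proof. exact: (continuous2_cvg _ (h := amul) (@amul_continuous _ E (x, y))). Qed.

End TopologicalAlgebraLimits.

Lemma near_finite_set (I : choiceType) (T : Type) (F : set_system T)
    {FF : Filter F} (G : set I) (Q : I -> T -> Prop) :
  finite_set G -> (forall i, G i -> \forall t \near F, Q i t) ->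
  \forall t \near F, forall i, G i -> Q i t.
Proof.
move=> /finite_fsetP[D ->] GQ.
have DQ i : i \in D -> F (Q i) by exact: GQ.
by have := filter_bigI FF DQ; apply: filterS => t Dt i; exact: Dt.
Qed.

Section SeminormTopology.
Context {R : realType} {E : topologicalLmodType R[i]} {P : set (E -> R)}.
Hypothesis topP : defines_topology P.

Lemma cvg_seminorms T (F : set_system T) {FF : Filter F} (f : T -> E) (x : E) :
  f @ F --> x <-> forall p, P p -> forall e, 0 < e -> \forall t \near F, p (f t - x) < e.
Proof.
split=> [fx p Pp e e0|fx U /topP[G [e [finG GP e0 GU]]]].
  apply: (fx [set y | p (y - x) < e]); apply/topP; exists [set p]; exists e.
  by split=> // [q ->//|y /= ->].
have fG p : G p -> \forall t \near F, p (f t - x) < e by move=> /GP Pp; exact: fx.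
by apply: filterS (near_finite_set finG fG) => t ft; exact: GU.
Qed.

End SeminormTopology.

Lemma increasing_defines_topology (R : realType) (E : topologicalLmodType R[i])
    (N : nat -> E -> R) :
  (forall k, seminorm (N k)) ->
  (forall k e x, 0 < e -> \forall y \near x, N k (y - x) < e) ->
  (forall (x : E) U, nbhs x U ->
    exists k, exists2 e, 0 < e & [set y | N k (y - x) < e] `<=` U) ->
  defines_topology (range N).
Proof.
move=> sN nearN nbhsN x U; split=> [/nbhsN[k [e e0 kU]]|[F [e [finF FN e0 FU]]]].
  exists [set N k]; exists e; split=> //; first by move=> _ ->; exists k.
  by move=> y /= yx; apply: kU => /=; exact: yx.
have Fx p : F p -> \forall y \near x, p (y - x) < e.
  by move=> /FN[k _ <-]; exact: nearN.
by apply: filterS (near_finite_set finF Fx) => y; exact: FU.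
Qed.

(** Since the [N k] increase, one and the same large index can serve both as
    the constant and as the seminorm, which lets the finite set be treated by
    intersecting finitely many neighbourhoods of infinity. *)
Lemma finite_dominated (R : realType) (E : Type) (N : nat -> E -> R) (F : set (E -> R)) :
  (forall k x, 0 <= N k x) -> (forall k l x, (k <= l)%N -> N k x <= N l x) -> finite_set F ->
  (forall p, F p -> exists M k, forall x, p x <= M * N k x) ->
  exists k, forall p, F p -> forall x, p x <= k.+1%:R * N k x.
Proof.
move=> N0 N_mono finF FN.
have : \forall k \near \oo, forall p, F p -> forall x, p x <= k.+1%:R * N k x.
  apply: near_finite_set => // p /FN[M [k pM]].
  near=> n => x; apply: le_trans (pM x) _.
  apply: (@le_trans _ _ (n.+1%:R * N k x)).
    rewrite ler_wpM2r//; near: n; apply: filterS (nbhs_infty_ger M) => n.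
    by move=> /le_trans; apply; rewrite ler_nat.
  by rewrite ler_wpM2l// N_mono//; near: n; exact: nbhs_infty_ge.
by move=> [k _ kF]; exists k => p Fp x; exact: kF (leqnn k) p Fp x.
Unshelve. all: by end_near. Qed.

(** * The completion for an increasing sequence of seminorms *)

Record seminorm_tower (R : realType) (A : assocAlgType R[i]) := SeminormTower {
  tower :> nat -> A -> R;
  tower_seminorm : forall k, seminorm (tower k);
  tower_submult : forall k, submultiplicative (tower k);
  tower_le : forall k x, tower k x <= tower k.+1 x
}.

Section CauchySequences.
Context {R : realType} {A : assocAlgType R[i]} {P : seminorm_tower A}.
Local Notation normc := (@ComplexField.Normc.normc R).
Implicit Types u v w : nat -> A.

Lemma tower_mono k l x : (k <= l)%N -> P k x <= P l x.
Proof.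
move=> /subnK <-; elim: (l - k)%N => // m IH; rewrite addSn.
exact: le_trans IH (tower_le _ _ _).
Qed.

Let sP k : seminorm (P k) := tower_seminorm P k.

(** The threshold is quantified by [near] so that finitely many Cauchy
    conditions combine by intersecting filters. *)
Definition tower_cauchy u := forall k e, 0 < e ->
  \forall N \near \oo, forall m n, (N <= m)%N -> (N <= n)%N -> P k (u m - u n) < e.

Definition tower_null u := forall k e, 0 < e -> \forall n \near \oo, P k (u n) < e.

Definition same_limit u v := tower_null (fun n => u n - v n).

(** Boundedness is needed to multiply Cauchy sequences and to see that null
    sequences absorb products with them. *)
Lemma tower_cauchy_bounded u k : tower_cauchy u ->
  exists2 M, 0 < M & \forall N \near \oo, forall n, (N <= n)%N -> P k (u n) < M.
Proof.
move=> /(_ k 1 ltr01)[N _ uN]; exists (P k (u N) + 1).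
  by rewrite ltr_wpDl// seminorm_ge0.
exists N => // i /= Ni n /(leq_trans Ni) Nn.
have unN : P k (u n - u N) < 1 := uN N (leqnn N) n N Nn (leqnn N).
apply: le_lt_trans (_ : P k (u n - u N) + P k (u N) < _).
  by rewrite -[X in P k X <= _](subrK (u N) (u n)) (seminormD (sP k)).
by rewrite addrC ltrD2l.
Qed.

Lemma tower_cauchy_cst a : tower_cauchy (fun=> a).
Proof.
by move=> k e e0; near=> N => m n _ _; rewrite subrr seminorm0.
Unshelve. all: by end_near. Qed.

Lemma tower_cauchy_lin a u v :
  tower_cauchy u -> tower_cauchy v -> tower_cauchy (fun n => a *: u n + v n).
Proof.
move=> cu cv k e e0; have a0 : 0 < normc a + 1 by rewrite ltr_wpDl// normc_ge0.
have := cv k _ (divr_gt0 e0 (ltr0Sn R 1)).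
have := cu k _ (divr_gt0 (divr_gt0 e0 (ltr0Sn R 1)) a0).
apply: filterS2 => N uN vN m n Nm Nn.
rewrite opprD addrACA -scalerBr (splitr e).
apply: (le_lt_trans (seminormD (sP k) _ _)); rewrite ltrD ?vN//.
rewrite (seminormZ (sP k)); apply: (le_lt_trans (_ : _ <= (normc a + 1) * P k (u m - u n))).
  by rewrite ler_wpM2r ?(seminorm_ge0 (sP k))// lerDl.
by rewrite mulrC -ltr_pdivlMr// uN.
Qed.

Lemma tower_cauchyM u v :
  tower_cauchy u -> tower_cauchy v -> tower_cauchy (fun n => u n ** v n).
Proof.
move=> cu cv k e e0.
have [M M0 uM] := tower_cauchy_bounded k cu.
have [M' M'0 vM] := tower_cauchy_bounded k cv.
have e20 := divr_gt0 e0 (ltr0Sn R 1).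
apply: filterS3 (cu k _ (divr_gt0 e20 M'0)) (cv k _ (divr_gt0 e20 M0))
  (filterI uM vM) => N uN vN [{}uM {}vM] m n Nm Nn.
rewrite (_ : _ - _ = (u m - u n) ** v m + u n ** (v m - v n)); last first.
  by rewrite amulBl amulBr subrKA.
rewrite (splitr e); apply: (le_lt_trans (seminormD (sP k) _ _)).
apply: ltrD; apply: (le_lt_trans (tower_submult P _ _ _)).
  apply: (le_lt_trans (_ : _ <= P k (u m - u n) * M')).
    by rewrite ler_wpM2l ?(seminorm_ge0 (sP k))// ltW// vM.
  by rewrite -ltr_pdivlMr// uN.
apply: (le_lt_trans (_ : _ <= M * P k (v m - v n))).
  by rewrite ler_wpM2r ?(seminorm_ge0 (sP k))// ltW// uM.
by rewrite mulrC -ltr_pdivlMr// vN.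
Qed.

Lemma same_limit_refl u : same_limit u u.
Proof.
by move=> k e e0; near=> n; rewrite subrr seminorm0.
Unshelve. all: by end_near. Qed.

Lemma same_limit_sym u v : same_limit u v -> same_limit v u.
Proof. by move=> uv k e /(uv k); apply: filterS => n; rewrite seminormBC. Qed.

Lemma same_limit_trans v u w : same_limit u v -> same_limit v w -> same_limit u w.
Proof.
move=> uv vw k e e0; have e20 := divr_gt0 e0 (ltr0Sn R 1).
apply: filterS2 (uv k _ e20) (vw k _ e20) => n un vn; rewrite (splitr e).
exact: (le_lt_trans (seminormB_trans (sP k) (v n) _ _)) (ltrD un vn).
Qed.

Lemma same_limit_cauchy u v : same_limit u v -> tower_cauchy u -> tower_cauchy v.
Proof.
move=> uv cu k e e0; have e20 := divr_gt0 e0 (ltr0Sn R 1).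
have e40 := divr_gt0 e20 (ltr0Sn R 1).
have [N _ uvN] := uv k _ e40; apply: filterS2 (cu k _ e20) (nbhs_infty_ge N).
move=> M uM NM m n Mm Mn; rewrite (splitr e).
apply: (le_lt_trans (seminormB_trans (sP k) (u n) _ _)).
have -> : e / 2 + e / 2 = (e / 2 / 2 + e / 2) + e / 2 / 2.
  by rewrite addrAC -(splitr (e / 2)).
apply: ltrD; last by apply: uvN; exact: leq_trans NM Mn.
apply: (le_lt_trans (seminormB_trans (sP k) (u m) _ _)).
apply: ltrD; last exact: uM.
by rewrite (seminormBC (sP k)); apply: uvN; exact: leq_trans NM Mm.
Qed.

Lemma same_limit_lin a u v u' v' : same_limit u u' -> same_limit v v' ->
  same_limit (fun n => a *: u n + v n) (fun n => a *: u' n + v' n).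
Proof.
move=> uu' vv' k e e0; have e20 := divr_gt0 e0 (ltr0Sn R 1).
have a0 : 0 < normc a + 1 by rewrite ltr_wpDl// normc_ge0.
apply: filterS2 (uu' k _ (divr_gt0 e20 a0)) (vv' k _ e20) => n un vn.
rewrite opprD addrACA -scalerBr (splitr e).
apply: (le_lt_trans (seminormD (sP k) _ _)); rewrite ltrD//.
rewrite (seminormZ (sP k)); apply: (le_lt_trans (_ : _ <= (normc a + 1) * P k (u n - u' n))).
  by rewrite ler_wpM2r ?(seminorm_ge0 (sP k))// lerDl.
by rewrite mulrC -ltr_pdivlMr.
Qed.

Lemma same_limitM u v u' v' : tower_cauchy u' -> tower_cauchy v ->
  same_limit u u' -> same_limit v v' ->
  same_limit (fun n => u n ** v n) (fun n => u' n ** v' n).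
Proof.
move=> cu' cv uu' vv' k e e0; have e20 := divr_gt0 e0 (ltr0Sn R 1).
have [M M0 uM] := tower_cauchy_bounded k cu'.
have [M' M'0 vM] := tower_cauchy_bounded k cv.
apply: filterS3 (uu' k _ (divr_gt0 e20 M'0)) (vv' k _ (divr_gt0 e20 M0))
  (filterI uM vM) => n un vn [/(_ n (leqnn n)) {}uM /(_ n (leqnn n)) {}vM].
rewrite (_ : _ - _ = (u n - u' n) ** v n + u' n ** (v n - v' n)); last first.
  by rewrite amulBl amulBr subrKA.
rewrite (splitr e); apply: (le_lt_trans (seminormD (sP k) _ _)).
apply: ltrD; apply: (le_lt_trans (tower_submult P _ _ _)).
  apply: (le_lt_trans (_ : _ <= P k (u n - u' n) * M')).
    by rewrite ler_wpM2l ?(seminorm_ge0 (sP k))// ltW.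
  by rewrite -ltr_pdivlMr.
apply: (le_lt_trans (_ : _ <= M * P k (v n - v' n))).
  by rewrite ler_wpM2r ?(seminorm_ge0 (sP k))// ltW.
by rewrite mulrC -ltr_pdivlMr.
Qed.

Lemma tower_cauchy_cvg u k : tower_cauchy u -> cvg (P k (u n) @[n --> \oo]).
Proof.
move=> cu; apply: cauchy_cvg; apply: cauchy_exP => e e0.
have [N _ uN] := cu k e e0; exists (P k (u N)); exists N => // n /= Nn.
apply: (le_lt_trans (seminorm_dist (sP k) _ _)).
exact: uN (leqnn N) _ _ (leqnn N) Nn.
Qed.

End CauchySequences.
Arguments tower_cauchy {R A} P u.
Arguments same_limit {R A} P u v.

Section Completion.
Context {R : realType} {A : assocAlgType R[i]} (P : seminorm_tower A).
Implicit Types u v w : nat -> A.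

(** An element is a whole class of Cauchy sequences with the same limit, so that
    equality of elements is equality of predicates. *)
Record completion := Completion {
  representatives :> (nat -> A) -> Prop;
  representativesP :
    exists2 u, tower_cauchy P u & representatives = same_limit P u
}.

Implicit Types x y z : completion.

HB.instance Definition _ := gen_eqMixin completion.
HB.instance Definition _ := gen_choiceMixin completion.

Definition completion_of u (cu : tower_cauchy P u) : completion :=
  Completion (ex_intro2 _ _ u cu erefl).

Lemma completion_ofP u (cu : tower_cauchy P u) : completion_of cu u.
Proof. exact: same_limit_refl. Qed.

Lemma representative_ex x : exists u, x u.
Proof. by case: x => s [u cu /= ->]; exists u; exact: same_limit_refl. Qed.

Definition rep x : nat -> A := sval (cid (representative_ex x)).

Lemma repP x : x (rep x). Proof. exact: svalP (cid (representative_ex x)). Qed.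

Lemma representative_cauchy x u : x u -> tower_cauchy P u.
Proof.
by case: x => s [v cv /= ->] vu; apply: same_limit_cauchy vu cv.
Qed.

Lemma representative_same x u v : x u -> x v <-> same_limit P u v.
Proof.
case: x => s [w cw /= ->] /= wu; split=> [|uv]; last exact: same_limit_trans wu uv.
by apply: same_limit_trans; exact: same_limit_sym.
Qed.

Lemma representative_inj x y u : x u -> y u -> x = y.
Proof.
move=> xu yu; have : x = y :> (_ -> Prop).
  by apply/funext => v; apply/propext; rewrite (representative_same _ xu) (representative_same _ yu).
case: x y {xu yu} => s hs [t ht] /= st.
by rewrite -st in ht *; congr Completion; exact: Prop_irrelevance.
Qed.

(** Addition, scaling and opposite are all instances of this one operation, which
    leaves a single well-definedness argument for the linear structure. *)
Let lin a x y := completion_of (tower_cauchy_lin a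
  (representative_cauchy (repP x)) (representative_cauchy (repP y))).

Let linP a x y u v : x u -> y v -> lin a x y (fun n => a *: u n + v n).
Proof.
move=> xu yv; rewrite (representative_same _ (completion_ofP _)).
by apply: same_limit_lin; apply/(representative_same _ (repP _)).
Qed.

Definition completion_zero := completion_of (tower_cauchy_cst (P := P) 0).
Definition completion_add x y := lin 1 x y.
Definition completion_scale a x := lin a x completion_zero.
Definition completion_opp x := completion_scale (-1) x.
Definition completion_one := completion_of (tower_cauchy_cst (P := P) aone).
Definition completion_mul x y := completion_of (tower_cauchyM
  (representative_cauchy (repP x)) (representative_cauchy (repP y))).

Let addP x y u v : x u -> y v -> completion_add x y (fun n => u n + v n).
Proof.
move=> xu yv; rewrite (_ : (fun n => _) = (fun n => 1 *: u n + v n)); first exact: linP.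
by apply/funext => n; rewrite scale1r.
Qed.

Let scaleP a x u : x u -> completion_scale a x (fun n => a *: u n).
Proof.
move=> xu; rewrite (_ : (fun n => _) = (fun n => a *: u n + 0)).
  by apply: linP => //; exact: completion_ofP.
by apply/funext => n; rewrite addr0.
Qed.

Let mulP x y u v : x u -> y v -> completion_mul x y (fun n => u n ** v n).
Proof.
move=> xu yv; rewrite (representative_same _ (completion_ofP _)).
apply: same_limitM.
- exact: representative_cauchy xu.
- exact: representative_cauchy (repP _).
- exact/(representative_same _ (repP _)).
- exact/(representative_same _ (repP _)).
Qed.

Let oppP x u : x u -> completion_opp x (fun n => - u n).
Proof.
move=> xu; rewrite (_ : (fun n => _) = (fun n => -1 *: u n)); first exact: scaleP.
by apply/funext => n; rewrite scaleN1r.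
Qed.

Let zeroP : completion_zero (fun=> 0). Proof. exact: completion_ofP. Qed.
Let oneP : completion_one (fun=> aone). Proof. exact: completion_ofP. Qed.

(** Every algebra law of the completion reduces through this to the same law,
    term by term, for representing sequences. *)
Let eqP x y u v : x u -> y v -> u =1 v -> x = y.
Proof. by move=> xu yv /funext uv; rewrite uv in xu; exact: representative_inj xu yv. Qed.

Let addA : associative completion_add.
Proof.
move=> x y z; apply: eqP (addP (repP x) (addP (repP y) (repP z)))
  (addP (addP (repP x) (repP y)) (repP z)) _ => n; exact: addrA.
Qed.

Let addC : commutative completion_add.
Proof.
move=> x y; apply: eqP (addP (repP x) (repP y)) (addP (repP y) (repP x)) _ => n; exact: addrC.
Qed.

Let add0 : left_id completion_zero completion_add.
Proof. by move=> x; apply: eqP (addP zeroP (repP x)) (repP x) _ => n; exact: add0r. Qed.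

Let addN : left_inverse completion_zero completion_opp completion_add.
Proof. by move=> x; apply: eqP (addP (oppP (repP x)) (repP x)) zeroP _ => n; exact: addNr. Qed.

HB.instance Definition _ := GRing.isZmodule.Build completion addA addC add0 addN.

Let scaleA a b x : completion_scale a (completion_scale b x) = completion_scale (a * b) x.
Proof.
by apply: eqP (scaleP a (scaleP b (repP x))) (scaleP _ (repP x)) _ => n; exact: scalerA.
Qed.

Let scale1 : left_id 1 completion_scale.
Proof. by move=> x; apply: eqP (scaleP _ (repP x)) (repP x) _ => n; exact: scale1r. Qed.

Let scaleDr : right_distributive completion_scale +%R.
Proof.
move=> a x y; apply: eqP (scaleP a (addP (repP x) (repP y)))
  (addP (scaleP a (repP x)) (scaleP a (repP y))) _ => n; exact: scalerDr.
Qed.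

Let scaleDl x : {morph completion_scale^~ x : a b / a + b}.
Proof.
move=> a b; apply: eqP (scaleP (a + b) (repP x))
  (addP (scaleP a (repP x)) (scaleP b (repP x))) _ => n; exact: scalerDl.
Qed.

HB.instance Definition _ := GRing.Zmodule_isLmodule.Build R[i] completion
  scaleA scale1 scaleDr scaleDl.

Let mulA : associative completion_mul.
Proof.
move=> x y z; apply: eqP (mulP (repP x) (mulP (repP y) (repP z)))
  (mulP (mulP (repP x) (repP y)) (repP z)) _ => n; exact: amulA.
Qed.

Let mul1 : left_id completion_one completion_mul.
Proof. by move=> x; apply: eqP (mulP oneP (repP x)) (repP x) _ => n; exact: amul1l. Qed.

Let mulr1 : right_id completion_one completion_mul.
Proof. by move=> x; apply: eqP (mulP (repP x) oneP) (repP x) _ => n; exact: amul1r. Qed.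

Let mulDl : left_distributive completion_mul +%R.
Proof.
move=> x y z; apply: eqP (mulP (addP (repP x) (repP y)) (repP z))
  (addP (mulP (repP x) (repP z)) (mulP (repP y) (repP z))) _ => n; exact: amulDl.
Qed.

Let mulDr : right_distributive completion_mul +%R.
Proof.
move=> z x y; apply: eqP (mulP (repP z) (addP (repP x) (repP y)))
  (addP (mulP (repP z) (repP x)) (mulP (repP z) (repP y))) _ => n; exact: amulDr.
Qed.

Let mulZl (a : R[i]) x y : completion_mul (a *: x) y = a *: completion_mul x y.
Proof.
by apply: eqP (mulP (scaleP a (repP x)) (repP y))
  (scaleP a (mulP (repP x) (repP y))) _ => n; exact: amulZl.
Qed.

Let mulZr (a : R[i]) x y : completion_mul x (a *: y) = a *: completion_mul x y.
Proof.
by apply: eqP (mulP (repP x) (scaleP a (repP y)))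
  (scaleP a (mulP (repP x) (repP y))) _ => n; exact: amulZr.
Qed.

HB.instance Definition _ := Lmodule_isAssocAlgebra.Build R[i] completion
  mulA mul1 mulr1 mulDl mulDr mulZl mulZr.

Lemma representative0 : (0 : completion) (fun=> 0). Proof. exact: zeroP. Qed.

Lemma representative1 : (aone : completion) (fun=> aone). Proof. exact: oneP. Qed.

Lemma representativeD x y u v : x u -> y v -> (x + y : completion)%R (fun n => u n + v n).
Proof. exact: addP. Qed.

Lemma representativeZ a x u : x u -> (a *: x : completion)%R (fun n => a *: u n).
Proof. exact: scaleP. Qed.

Lemma representativeB x y u v : x u -> y v -> (x - y : completion)%R (fun n => u n - v n).
Proof. by move=> xu yv; apply: addP => //; exact: oppP. Qed.

Lemma representativeM x y u v : x u -> y v -> (x ** y : completion)%R (fun n => u n ** v n).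
Proof. exact: mulP. Qed.

End Completion.

(** * Norms and topology of the completion *)

Section CompletionNorms.
Context {R : realType} {A : assocAlgType R[i]} (P : seminorm_tower A).
Local Notation C := (completion P).
Local Notation normc := (@ComplexField.Normc.normc R).
Implicit Types (x y z : C) (u v : nat -> A).

Let sP k : seminorm (P k) := tower_seminorm P k.

Definition completion_norm k x : R := limn (fun n => P k (rep x n)).

Lemma completion_norm_cvg k x u : x u -> P k (u n) @[n --> \oo] --> completion_norm k x.
Proof.
move=> xu; have /cvgrPdist_lt rx : P k (rep x n) @[n --> \oo] --> completion_norm k x.
  by apply: tower_cauchy_cvg; exact: representative_cauchy (repP x).
apply/cvgrPdist_lt => e e0; have e20 := divr_gt0 e0 (ltr0Sn R 1).
have /(_ k _ e20) ru := (representative_same _ (repP x)).1 xu.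
apply: filterS2 (rx _ e20) ru => n xn un; rewrite (splitr e).
apply: (le_lt_trans (ler_distD (P k (rep x n)) _ _)); apply: ltrD => //.
exact: le_lt_trans (seminorm_dist (sP k) _ _) un.
Qed.

Arguments completion_norm_cvg k {x u}.

Lemma completion_norm_le k x u r : x u ->
  (\forall n \near \oo, P k (u n) <= r) -> completion_norm k x <= r.
Proof.
move=> xu ur; exact: (cvgr_to_le (completion_norm_cvg k xu) ur).
Qed.

Lemma completion_seminorm k : seminorm (completion_norm k).
Proof.
split=> [x|x y|a x].
- apply: (cvgr_to_ge (completion_norm_cvg k (repP x))).
  by near=> n; exact: seminorm_ge0.
- have xy := completion_norm_cvg k (representativeD (repP x) (repP y)).
  apply: (ler_cvg_to xy (cvgD (completion_norm_cvg k (repP x)) (completion_norm_cvg k (repP y)))).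
  by near=> n; exact: seminormD.
- have := completion_norm_cvg k (representativeZ a (repP x)).
  move=> /cvg_unique; apply => //.
  rewrite (_ : (fun n => _) = fun n => normc a * P k (rep x n)); last first.
    by apply/funext => n; rewrite seminormZ.
  by apply: cvgMl_tmp; exact: completion_norm_cvg (repP x).
Unshelve. all: by end_near. Qed.

Lemma completion_norm_submult k : submultiplicative (completion_norm k).
Proof.
move=> x y; have xy := completion_norm_cvg k (representativeM (repP x) (repP y)).
apply: (ler_cvg_to xy (cvgM (completion_norm_cvg k (repP x)) (completion_norm_cvg k (repP y)))).
by near=> n; exact: tower_submult.
Unshelve. all: by end_near. Qed.

Lemma completion_norm_mono k l x : (k <= l)%N -> completion_norm k x <= completion_norm l x.
Proof.
move=> kl; apply: (ler_cvg_to (completion_norm_cvg k (repP x)) (completion_norm_cvg l (repP x))).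
by near=> n; exact: tower_mono.
Unshelve. all: by end_near. Qed.

Lemma completion_norm_eq0 x : (forall k, completion_norm k x = 0) -> x = 0.
Proof.
move=> x0; apply: representative_inj (repP x) _.
apply/(representative_same _ (representative0 P)) => k e e0.
have := completion_norm_cvg k (repP x); rewrite x0 => /cvgr_lt/(_ e e0).
by apply: filterS => n /=; rewrite sub0r seminormN.
Qed.

Definition embed (a : A) : C := completion_of (tower_cauchy_cst (P := P) a).

Lemma embedP a : embed a (fun=> a). Proof. exact: completion_ofP. Qed.

Lemma embed_alg_hom : alg_hom embed.
Proof.
split=> [a x y||x y].
- apply: representative_inj (embedP _) _.
  exact: representativeD (representativeZ _ (embedP x)) (embedP y).
- exact: representative_inj (embedP _) (representative1 P).
- exact: representative_inj (embedP _) (representativeM (embedP x) (embedP y)).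
Qed.

Lemma completion_norm_embed k a : completion_norm k (embed a) = P k a.
Proof. by have /cvg_unique := completion_norm_cvg k (embedP a); apply=> //; exact: cvg_cst. Qed.

(** The tail [u m - u n] represents the difference, and it is small for the
    Cauchy sequence [u]: density of [A] in the completion, with an explicit
    approximating sequence. *)
Lemma embed_approx x u k e : x u -> 0 < e ->
  \forall n \near \oo, completion_norm k (x - embed (u n)) < e.
Proof.
move=> xu e0; have e20 := divr_gt0 e0 (ltr0Sn R 1).
have [N _ uN] := representative_cauchy xu k e20.
exists N => // n /= Nn; apply: (@le_lt_trans _ _ (e / 2)).
  apply: completion_norm_le (representativeB xu (embedP _)) _.
  by exists N => // m /= Nm; apply/ltW; exact: uN (leqnn N) _ _ Nm Nn.
by rewrite ltr_pdivrMr// ltr_pMr// ltr1n.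
Qed.

End CompletionNorms.
Global Opaque completion_norm.

Section CompletionTopology.
Context {R : realType} {A : assocAlgType R[i]} {P : seminorm_tower A}.
Local Notation C := (completion P).
Local Notation normc := (@ComplexField.Normc.normc R).
Local Notation "''N_' k" := (completion_norm k) (at level 8, k at level 2, format "''N_' k").
Implicit Types (x y z : C).

Let sN k : seminorm (@completion_norm _ _ P k) := completion_seminorm P k.

(** One seminorm and one radius suffice in a basic neighbourhood, because the
    seminorms increase with the index. *)
Definition completion_nbhs x : set_system C :=
  [set U | exists k, exists2 e, 0 < e & [set y | 'N_k (y - x) < e] `<=` U].

HB.instance Definition _ := hasNbhs.Build C completion_nbhs.

Lemma nbhs_completionP x (U : set C) : nbhs x U <->
  exists k, exists2 e, 0 < e & [set y | 'N_k (y - x) < e] `<=` U.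
Proof. by []. Qed.

Let nbhs_filter x : ProperFilter (nbhs x).
Proof.
split.
  move=> /nbhs_completionP[k [e e0 /(_ x)]]; apply => /=.
  by rewrite subrr (seminorm0 (sN k)).
split.
- by exists 0%N; exists 1.
- move=> U V /nbhs_completionP[k [e e0 kU]] /nbhs_completionP[l [d d0 lV]].
  exists (maxn k l); exists (Order.min e d); first by rewrite lt_min e0.
  move=> y /=; rewrite lt_min => /andP[ye yd]; split.
    by apply: kU; apply: le_lt_trans ye; apply: completion_norm_mono; exact: leq_maxl.
  by apply: lV; apply: le_lt_trans yd; apply: completion_norm_mono; exact: leq_maxr.
- by move=> U V UV [k [e e0 kU]]; exists k; exists e => //; exact: subset_trans UV.
Qed.

Let nbhs_singleton x (U : set C) : nbhs x U -> U x.
Proof.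
by move=> /nbhs_completionP[k [e e0]]; apply => /=; rewrite subrr (seminorm0 (sN k)).
Qed.

Let nbhs_nbhs x (U : set C) : nbhs x U -> nbhs x (nbhs^~ U).
Proof.
move=> /nbhs_completionP[k [e e0 kU]]; have e20 := divr_gt0 e0 (ltr0Sn R 1).
exists k; exists (e / 2) => // y /= yx; exists k; exists (e / 2) => // z /= zy.
apply: kU; rewrite /= (splitr e).
exact: le_lt_trans (seminormB_trans (sN k) y _ _) (ltrD zy yx).
Qed.

HB.instance Definition _ :=
  Nbhs_isNbhsTopological.Build C nbhs_filter nbhs_singleton nbhs_nbhs.

Lemma nbhs_completion_norm x k e : 0 < e -> \forall y \near x, 'N_k (y - x) < e.
Proof. by move=> e0; exists k; exists e. Qed.

Let sub_continuous : continuous (fun xy : C * C => xy.1 - xy.2).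
Proof.
move=> [x y] /= U /nbhs_completionP[k [e e0 kU]].
have e20 := divr_gt0 e0 (ltr0Sn R 1).
exists ([set z | 'N_k (z - x) < e / 2], [set z | 'N_k (z - y) < e / 2]).
  by split; exact: nbhs_completion_norm.
move=> [x' y'] /= [xx' yy']; apply: kU => /=; rewrite (splitr e).
rewrite (_ : _ - _ = (x' - x) - (y' - y)); last by rewrite opprD addrACA -opprD.
apply: (le_lt_trans (seminormD (sN k) _ _)); rewrite (seminormN (sN k)).
exact: ltrD.
Qed.

HB.instance Definition _ := PreTopologicalNmodule_isTopologicalZmodule.Build C sub_continuous.

Let mul_continuous : continuous (fun xy : C * C => xy.1 ** xy.2).
Proof.
move=> [x y] /= U /nbhs_completionP[k [e e0 kU]].
have e20 := divr_gt0 e0 (ltr0Sn R 1).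
have x0 : 0 < 'N_k x + 1 by rewrite ltr_wpDl// (seminorm_ge0 (sN k)).
have y0 : 0 < 'N_k y + 1 by rewrite ltr_wpDl// (seminorm_ge0 (sN k)).
pose d := Order.min 1 (e / 2 / ('N_k x + 1)).
have d0 : 0 < d by rewrite lt_min ltr01 divr_gt0.
exists ([set z | 'N_k (z - x) < e / 2 / ('N_k y + 1)], [set z | 'N_k (z - y) < d]).
  by split; apply: nbhs_completion_norm => //; exact: divr_gt0.
move=> [x' y'] /= [xx']; rewrite lt_min => /andP[yy'1 yy']; apply: kU => /=.
rewrite (_ : _ - _ = (x' - x) ** y' + x ** (y' - y)); last first.
  by rewrite amulBl amulBr subrKA.
rewrite (splitr e); apply: (le_lt_trans (seminormD (sN k) _ _)).
apply: ltrD; apply: (le_lt_trans (completion_norm_submult k _ _)).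
  apply: (@le_lt_trans _ _ ('N_k (x' - x) * ('N_k y + 1))); last by rewrite -ltr_pdivlMr.
  rewrite ler_wpM2l ?(seminorm_ge0 (sN k))//.
  rewrite -[X in 'N_k X](subrK y) addrC (le_trans (seminormD (sN k) _ _))//.
  by rewrite lerD2l ltW.
apply: (@le_lt_trans _ _ ('N_k (y' - y) * ('N_k x + 1))); last by rewrite -ltr_pdivlMr.
by rewrite mulrC ler_wpM2l ?(seminorm_ge0 (sN k))// lerDl.
Qed.

Let scale_continuous : continuous (fun ax : R[i]^o * C => ax.1 *: ax.2).
Proof.
move=> [a x] /= U /nbhs_completionP[k [e e0 kU]].
have e20 := divr_gt0 e0 (ltr0Sn R 1).
have a0 : 0 < normc a + 1 by rewrite ltr_wpDl// normc_ge0.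
have x0 : 0 < 'N_k x + 1 by rewrite ltr_wpDl// (seminorm_ge0 (sN k)).
pose d := Order.min 1 (e / 2 / (normc a + 1)).
have d0 : 0 < d by rewrite lt_min ltr01 divr_gt0.
exists ([set b | normc (b - a) < e / 2 / ('N_k x + 1)], [set z | 'N_k (z - x) < d]).
  split; last exact: nbhs_completion_norm.
  have r0 : 0 < (e / 2 / ('N_k x + 1))%:C%C by rewrite ltcR divr_gt0.
  apply: filterS (nbhsx_ballx (a : R[i]^o) _ r0) => b /=.
  by rewrite /ball /= distrC normrcE ltcR.
move=> [b x'] /= [ab]; rewrite lt_min => /andP[xx'1 xx']; apply: kU => /=.
rewrite (_ : _ - _ = (b - a) *: x' + a *: (x' - x)); last first.
  by rewrite scalerBl scalerBr subrKA.
rewrite (splitr e); apply: (le_lt_trans (seminormD (sN k) _ _)).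
apply: ltrD; rewrite (seminormZ (sN k)).
  apply: (@le_lt_trans _ _ (normc (b - a) * ('N_k x + 1))); last by rewrite -ltr_pdivlMr.
  rewrite ler_wpM2l ?normc_ge0//.
  rewrite -[X in 'N_k X](subrK x) addrC (le_trans (seminormD (sN k) _ _))//.
  by rewrite lerD2l ltW.
apply: (@le_lt_trans _ _ ('N_k (x' - x) * (normc a + 1))); last by rewrite -ltr_pdivlMr.
by rewrite mulrC ler_wpM2l ?(seminorm_ge0 (sN k))// lerDl.
Qed.

HB.instance Definition _ := TopologicalZmodule_isTopologicalLmodule.Build R[i] C scale_continuous.
HB.instance Definition _ := AssocAlgebra_isTopologicalAlgebra.Build R[i] C mul_continuous.

End CompletionTopology.

(** * The completion is an Arens-Michael algebra *)

Section CompletionComplete.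
Context {R : realType} {A : assocAlgType R[i]} {P : seminorm_tower A}.
Local Notation C := (completion P).
Local Notation "''N_' k" := (@completion_norm _ _ P k) (at level 8, k at level 2, format "''N_' k").
Implicit Types (x y z : C).

Let sN k : seminorm ('N_k) := completion_seminorm P k.

Lemma completion_topology : defines_topology (range (@completion_norm _ _ P)).
Proof.
apply: increasing_defines_topology => [k|k e x|x U /nbhs_completionP//].
- exact: completion_seminorm.
- exact: nbhs_completion_norm.
Qed.

Lemma completion_hausdorff : hausdorff_space C.
Proof.
move=> x y xy; apply/subr0_eq; apply: completion_norm_eq0 => k.
apply/eqP; rewrite eq_le (seminorm_ge0 (sN k)) andbT leNgt; apply/negP => e0.
have e20 := divr_gt0 e0 (ltr0Sn R 1).
have [z [/= zx zy]] := xy _ _ (nbhs_completion_norm x k e20) (nbhs_completion_norm y k e20).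
have := seminormB_trans (sN k) z x y; rewrite (seminormBC (sN k) x z).
apply/negP; rewrite -ltNge [ltRHS](splitr ('N_k (x - y))); exact: ltrD zx zy.
Qed.

Lemma invSn_cvg (e : R) : 0 < e -> exists N, forall n, (N <= n)%N -> n.+1%:R^-1 < e.
Proof. by move=> e0; have [N _ h] := near_infty_natSinv_lt (PosNum e0); exists N. Qed.

(** A diagonal argument.  The filter contains sets [S j] of [j]-th diameter less
    than [1/(j+1)]; a point [x j] in the first [j+1] of them is approximated by
    [a j] in [A] to within [1/(j+1)] for the [j]-th norm.  The sequence [a] is
    Cauchy for all the seminorms, and the filter converges to the element that it
    represents. *)
Lemma completion_complete : complete_space C.
Proof.
move=> F PF cF.
have small k e : 0 < e -> exists2 S, F S & forall x y, S x -> S y -> 'N_k (x - y) < e.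
  move=> e0; have := cF _ (nbhs_completion_norm 0 k e0).
  move=> [[S T] /= [FS FT] ST]; exists (S `&` T); first exact: filterI.
  by move=> x y [Sx _] [_ Ty]; have := ST (x, y) (conj Sx Ty); rewrite /= subr0.
have /choice[S SP] (j : nat) : exists S, F S /\
    forall x y, S x -> S y -> 'N_j (x - y) < j.+1%:R^-1.
  by have [|S FS Sj] := small j j.+1%:R^-1; [rewrite invr_gt0|exists S].
have /choice[x xS] (j : nat) : exists x, forall i, (i <= j)%N -> S i x.
  apply: (@filter_ex _ F).
  have Fi (i : 'I_j.+1) : F (S i) by have [] := SP i.
  elim: j {Fi} => [|j IH].
    by apply: filterS (SP 0%N).1 => x Sx i; rewrite leqn0 => /eqP ->.
  apply: filterS2 IH (SP j.+1).1 => x Sx Sjx i.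
  by rewrite leq_eqVlt => /predU1P[->//|]; rewrite ltnS; exact: Sx.
have /choice[a ax] (j : nat) : exists a, 'N_j (x j - embed P a) < j.+1%:R^-1.
  have j0 : 0 < j.+1%:R^-1 :> R by rewrite invr_gt0.
  have [n _ xn] := embed_approx j (repP (x j)) j0.
  by exists (rep (x j) n); exact: xn (leqnn n).
(* With [k <= N <= n], every point of [S N] is within [1/(N+1)] of [x n], which
   itself is within [1/(N+1)] of [a n]. *)
have near_a N k n y : (k <= N)%N -> (N <= n)%N -> S N y ->
    'N_k (y - embed P (a n)) < 2 * N.+1%:R^-1.
  move=> kN Nn Sy; apply: (le_lt_trans (completion_norm_mono _ kN)).
  apply: (le_lt_trans (seminormB_trans (sN N) (x n) _ _)).
  rewrite mulr_natl mulr2n ltrD//; first exact: (SP N).2 Sy (xS _ _ Nn).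
  apply: (le_lt_trans (completion_norm_mono _ Nn)); apply: lt_le_trans (ax n) _.
  by rewrite lef_pV2 ?posrE// ler_nat ltnS.
have ca : tower_cauchy P a.
  move=> k e e0; have [N0 N0e] := invSn_cvg (divr_gt0 e0 (ltr0Sn R 3)).
  exists (maxn N0 k) => // N /=; rewrite geq_max => /andP[N0N kN] m n Nm Nn.
  rewrite -completion_norm_embed.
  rewrite (alg_homB (embed_alg_hom P)).
  apply: (le_lt_trans (seminormB_trans (sN k) (x N) _ _)).
  rewrite (seminormBC (sN k)).
  have SN : S N (x N) by exact: xS.
  apply: (lt_le_trans (ltrD (near_a N k m _ kN Nm SN) (near_a N k n _ kN Nn SN))).
  rewrite -mulrDl -natrD (_ : (2 + 2)%N = 4%N)//.
  by rewrite mulrC -ler_pdivlMr// ltW// N0e.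
exists (completion_of ca) => U /nbhs_completionP[k [e e0 kU]].
have [N0 N0e] := invSn_cvg (divr_gt0 e0 (ltr0Sn R 3)).
pose N := maxn N0 k.
apply: filterS (SP N).1 => y Sy; apply: kU => /=.
have e20 := divr_gt0 e0 (ltr0Sn R 1).
have [n Nn an] : exists2 n, (N <= n)%N & 'N_k (completion_of ca - embed P (a n)) < e / 2.
  have [n _ na] := embed_approx k (completion_ofP ca) e20.
  exists (maxn N n); first exact: leq_maxl.
  by apply: na; exact: leq_maxr.
rewrite (splitr e); apply: (le_lt_trans (seminormB_trans (sN k) (embed P (a n)) _ _)).
apply: ltrD; last by rewrite (seminormBC (sN k)); exact: an.
apply: (lt_le_trans (near_a N k n y (leq_maxr _ _) Nn Sy)) => {an}.
rewrite mulrC -ler_pdivlMr// -mulrA -invfM -natrM.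
by rewrite ltW// N0e// leq_maxl.
Qed.

Lemma completion_arens_michael : arens_michael C.
Proof.
split; [|exact: completion_hausdorff|exact: completion_complete].
exists (range (@completion_norm _ _ P)); split; last exact: completion_topology.
by move=> _ [k _ <-]; split; [exact: completion_seminorm|exact: completion_norm_submult].
Qed.

End CompletionComplete.

(** * Extension of homomorphisms to the completion *)

Lemma dominated_pos (R : realType) (A : assocAlgType R[i]) (P : seminorm_tower A)
    (E : Type) (Q : set (E -> R)) (phi : A -> E) (q : E -> R) :
  (forall q, Q q -> exists M k, forall a, q (phi a) <= M * P k a) -> Q q ->
  exists M k, 0 < M /\ forall a, q (phi a) <= M * P k a.
Proof.
move=> phi_dom /phi_dom[M [k qM]].
exists (Num.max M 1), k; split; first by rewrite lt_max ltr01 orbT.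
move=> a; apply: le_trans (qM a) _; rewrite ler_wpM2r ?le_max ?lexx//.
exact: seminorm_ge0 (tower_seminorm P k) a.
Qed.

Section Extension.
Context {R : realType} {A : assocAlgType R[i]} {P : seminorm_tower A}.
Context {E : topAlgType R[i]} {Q : set (E -> R)}.
Hypotheses (sQ : forall q, Q q -> seminorm q) (topQ : defines_topology Q).
Hypotheses (hausE : hausdorff_space E) (complE : complete_space E).
Context {phi : A -> E} (phi_hom : alg_hom phi).
Hypothesis phi_dom : forall q, Q q -> exists M k, forall a, q (phi a) <= M * P k a.
Local Notation C := (completion P).
Local Notation "''N_' k" := (@completion_norm _ _ P k) (at level 8, k at level 2, format "''N_' k").
Implicit Types (x : C) (u : nat -> A).

Let phiB a b : phi (a - b) = phi a - phi b. Proof. exact: alg_homB. Qed.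

(** Domination by the tower turns Cauchy sequences for [P] into Cauchy filters
    of [E], which is complete. *)
Lemma image_cauchy_cvg u : tower_cauchy P u -> exists y : E, phi (u n) @[n --> \oo] --> y.
Proof.
move=> cu.
apply: (complE (F := phi (u n) @[n --> \oo])).
apply: (cvg_seminorms topQ _ _).2 => q Qq e e0.
have [M [k [M0 qM]]] := dominated_pos phi_dom Qq.
have [N _ uN] := cu k _ (divr_gt0 e0 M0).
pose tail := [set phi (u n) | n in [set n | (N <= n)%N]]; exists (tail, tail).
  by split; exists N => // n Nn; exists n.
move=> [_ _] /= [[m Nm <-] [n Nn <-]]; rewrite subr0 -phiB.
apply: (le_lt_trans (qM _)); rewrite mulrC -ltr_pdivlMr//.
exact: uN (leqnn N) m n Nm Nn.
Qed.

Lemma null_cvg0 u : tower_null (P := P) u -> phi (u n) @[n --> \oo] --> (0 : E).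
Proof.
move=> nu; apply/(cvg_seminorms topQ) => q Qq e e0.
have [M [k [M0 qM]]] := dominated_pos phi_dom Qq.
apply: filterS (nu k _ (divr_gt0 e0 M0)) => n un; rewrite subr0.
by apply: (le_lt_trans (qM _)); rewrite mulrC -ltr_pdivlMr.
Qed.

Definition extension (x : C) : E :=
  sval (cid (image_cauchy_cvg (representative_cauchy (repP x)))).

Lemma extension_cvg x u : x u -> phi (u n) @[n --> \oo] --> extension x.
Proof.
move=> xu.
have rx : phi (rep x n) @[n --> \oo] --> extension x
  by exact: (svalP (cid (image_cauchy_cvg (representative_cauchy (repP x))))).
have /null_cvg0 ru := same_limit_sym ((representative_same _ (repP x)).1 xu).
rewrite (_ : (fun n => _) = (fun n => phi (u n - rep x n) + phi (rep x n))); last first.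
  by apply/funext => n; rewrite phiB subrK.
rewrite -[extension x]add0r.
exact: tlmod_cvgD ru rx.
Qed.

Lemma extension_unique x u (y : E) : x u -> phi (u n) @[n --> \oo] --> y -> extension x = y.
Proof. by move=> /extension_cvg xu uy; exact: (cvg_unique _ xu uy). Qed.

Lemma extension_embed a : extension (embed P a) = phi a.
Proof. by apply: extension_unique (embedP P a) _; exact: cvg_cst. Qed.

Lemma extension_alg_hom : alg_hom extension.
Proof.
have [phi_lin phi1 phiM] := phi_hom; split=> [a x y||x y].
- apply: extension_unique (representativeD (representativeZ a (repP x)) (repP y)) _.
  rewrite (_ : (fun n => _) = (fun n => a *: phi (rep x n) + phi (rep y n))); last first.
    by apply/funext => n; rewrite phi_lin.
  apply: tlmod_cvgD; last exact: extension_cvg (repP y).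
  by apply: tlmod_cvgZ; exact: extension_cvg (repP x).
- by apply: extension_unique (representative1 P) _; rewrite phi1; exact: cvg_cst.
- apply: extension_unique (representativeM (repP x) (repP y)) _.
  rewrite (_ : (fun n => _) = (fun n => phi (rep x n) ** phi (rep y n))); last first.
    by apply/funext => n; rewrite phiM.
  by apply: topalg_cvgM; apply: extension_cvg; exact: repP.
Qed.

(** The bound on [A] passes to the limit along a representing sequence; this is
    the continuity of the extension in quantitative form. *)
Lemma extension_dom q M k : Q q -> (forall a, q (phi a) <= M * P k a) ->
  forall x, q (extension x) <= M * 'N_k x.
Proof.
move=> Qq qM x; apply/ler_addgt0Pr => e e0.
have xr := extension_cvg (repP x).
have near_q := (cvg_seminorms topQ _ _).1 xr q Qq e e0.
have MP : M * P k (rep x n) + e @[n --> \oo] --> M * 'N_k x + e.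
  by apply: cvgD (cvg_cst _); apply: cvgMl_tmp; exact: completion_norm_cvg (repP x).
apply: (cvgr_to_ge MP); case: near_q => N _ qN; exists N => // n /= /qN /= qn.
rewrite -[extension x](subrK (phi (rep x n))) addrC.
apply: (le_trans (seminormD (sQ Qq) _ _)); rewrite lerD//.
by rewrite (seminormBC (sQ Qq)) ltW.
Qed.

Lemma extension_continuous : continuous extension.
Proof.
move=> x; apply: (cvg_seminorms topQ (F := nbhs x) extension _).2 => q Qq e e0.
have [M [k [M0 qM]]] := dominated_pos phi_dom Qq.
exists k; exists (e / M) => [|y /= yx]; first exact: divr_gt0.
rewrite -(alg_homB extension_alg_hom).
apply: (le_lt_trans (extension_dom Qq qM _)).
by rewrite mulrC -ltr_pdivlMr.
Qed.

End Extension.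

(** * Weighted word seminorms on a finitely generated algebra *)

Lemma sum_pred1_uniq (V : nmodType) (I : eqType) (D : seq I) (i : I) (F : I -> V) :
  uniq D -> i \in D -> \sum_(j <- D | i == j) F j = F i.
Proof.
move=> uD iD; rewrite (eq_bigl (fun j => j == i)) => [|j]; last exact: eq_sym.
by rewrite -big_filter (filter_pred1_uniq uD iD) big_seq1.
Qed.

Section FormalSums.
Context {R : realType} {A : assocAlgType R[i]} {n : nat} (s : 'I_n -> A).
Local Notation normc := (@ComplexField.Normc.normc R).
Local Notation word := (seq 'I_n).
Local Notation formal := (seq (R[i] * word)).
Implicit Types (l m : formal) (v w : word).

(** A noncommutative polynomial is kept as a list of monomials, possibly with
    repeated words: evaluation and weight are then sums over the list, and the
    weight is exactly multiplicative, with no cancellation to account for. *)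
Definition formal_eval l : A := \sum_(t <- l) t.1 *: word_eval s t.2.

Definition formal_weight (r : R) l : R := \sum_(t <- l) normc t.1 * r ^+ size t.2.

Definition formal_scale (a : R[i]) l : formal := [seq (a * t.1, t.2) | t <- l].

Definition formal_mul l m : formal := [seq (t.1 * t'.1, t.2 ++ t'.2) | t <- l, t' <- m].

Definition formal_coef l w : R[i] := \sum_(t <- l | t.2 == w) t.1.

Lemma word_eval_cat v w : word_eval s (v ++ w) = word_eval s v ** word_eval s w.
Proof. by elim: v => [|i v IH] /=; rewrite ?amul1l// IH amulA. Qed.

Lemma formal_eval_cat l m : formal_eval (l ++ m) = formal_eval l + formal_eval m.
Proof. exact: big_cat. Qed.

Lemma formal_eval_scale a l : formal_eval (formal_scale a l) = a *: formal_eval l.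
Proof.
by rewrite /formal_eval big_map scaler_sumr; apply: eq_bigr => t _; rewrite scalerA.
Qed.

Lemma formal_eval_mul l m : formal_eval (formal_mul l m) = formal_eval l ** formal_eval m.
Proof.
rewrite /formal_eval big_allpairs_dep /=.
rewrite (big_morph (fun x => x ** _) (fun x y => amulDl x y _) (amul0l _)).
apply: eq_bigr => t _; rewrite (big_morph _ (amulDr _) (amul0r _)).
by apply: eq_bigr => t' _; rewrite word_eval_cat amulZl amulZr scalerA.
Qed.

Lemma formal_weight_ge0 r l : 0 <= r -> 0 <= formal_weight r l.
Proof. by move=> r0; apply: sumr_ge0 => t _; rewrite mulr_ge0 ?normc_ge0 ?exprn_ge0. Qed.

Lemma formal_weight_le r r' l : 0 <= r -> r <= r' -> formal_weight r l <= formal_weight r' l.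
Proof.
move=> r0 rr'; apply: ler_sum => t _; rewrite ler_wpM2l ?normc_ge0//.
by rewrite lerXn2r ?nnegrE// (le_trans r0).
Qed.

Lemma formal_weight_cat r l m : formal_weight r (l ++ m) = formal_weight r l + formal_weight r m.
Proof. exact: big_cat. Qed.

Lemma formal_weight_scale r a l : formal_weight r (formal_scale a l) = normc a * formal_weight r l.
Proof.
rewrite /formal_weight big_map mulr_sumr; apply: eq_bigr => t _ /=.
by rewrite Normc.normcM mulrA.
Qed.

Lemma formal_weight_mul r l m :
  formal_weight r (formal_mul l m) = formal_weight r l * formal_weight r m.
Proof.
rewrite /formal_weight big_allpairs_dep /= mulr_suml.
apply: eq_bigr => t _; rewrite mulr_sumr; apply: eq_bigr => t' _.
by rewrite Normc.normcM size_cat exprD mulrACA.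
Qed.

Lemma sum_formal_coef l (D : seq word) : uniq D -> {subset [seq t.2 | t <- l] <= D} ->
  \sum_(w <- D) formal_coef l w *: word_eval s w = formal_eval l.
Proof.
move=> uD lD; under eq_bigr do rewrite /formal_coef scaler_suml.
rewrite (exchange_big_dep predT)//= /formal_eval [LHS]big_seq [RHS]big_seq.
by apply: eq_bigr => t tl; rewrite sum_pred1_uniq// lD// map_f.
Qed.

(** Collecting equal words can only decrease the weight, by the triangle
    inequality. *)
Lemma sum_normc_formal_coef r l (D : seq word) : 0 <= r -> uniq D ->
  \sum_(w <- D) normc (formal_coef l w) * r ^+ size w <= formal_weight r l.
Proof.
move=> r0 uD.
apply: (@le_trans _ _ (\sum_(w <- D) \sum_(t <- l | t.2 == w) normc t.1 * r ^+ size t.2)).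
  apply: ler_sum => w _.
  under eq_bigr => t /eqP -> do over.
  rewrite -mulr_suml ler_wpM2r ?exprn_ge0//.
  rewrite /formal_coef; elim/big_ind2: _ => [|x a y b xa yb|//]; first by rewrite Normc.normc0.
  exact: le_trans (ler_normcD _ _) (lerD xa yb).
rewrite (exchange_big_dep predT)//=; apply: ler_sum => t _.
have [tD|tD] := boolP (t.2 \in D); first by rewrite sum_pred1_uniq.
rewrite big1_seq ?mulr_ge0 ?normc_ge0 ?exprn_ge0// => w /andP[/eqP tw wD].
by rewrite tw wD in tD.
Qed.

Lemma seminorm_formal_eval (q : A -> R) (M r : R) : seminorm q ->
  (forall w, q (word_eval s w) <= M * r ^+ size w) ->
  forall l, q (formal_eval l) <= M * formal_weight r l.
Proof.
move=> sq qM l; apply: (le_trans (seminorm_sum sq _ _ _)).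
rewrite /formal_weight mulr_sumr; apply: ler_sum => t _.
by rewrite (seminormZ sq) mulrCA ler_wpM2l ?normc_ge0.
Qed.

Lemma submult_word_eval (q : A -> R) (r : R) : seminorm q -> submultiplicative q ->
  (forall i, q (s i) <= r) -> forall w, q (word_eval s w) <= q aone * r ^+ size w.
Proof.
move=> sq mq sr; elim=> [|i w IH] /=; first by rewrite mulr1.
apply: (le_trans (mq _ _)); rewrite exprS mulrCA.
by apply: ler_pM => //; exact: seminorm_ge0.
Qed.

Lemma finitely_generated_formal :
  smallest (@subalgebra _ A) (range s) = [set: A] -> forall a, exists l, formal_eval l = a.
Proof.
move=> gen a; have : smallest (@subalgebra _ A) (range s) a by rewrite gen.
move/(_ [set b | exists l, formal_eval l = b]); apply; split; [split|].
- by exists [:: (1, [::])]; rewrite /formal_eval big_seq1 scale1r.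
- move=> c _ _ [l <-] [m <-]; exists (formal_scale c l ++ m).
  by rewrite formal_eval_cat formal_eval_scale.
- by move=> _ _ [l <-] [m <-]; exists (formal_mul l m); exact: formal_eval_mul.
- move=> _ [i _ <-]; exists [:: (1, [:: i])].
  by rewrite /formal_eval big_seq1 scale1r /= amul1r.
Qed.

End FormalSums.

Section WordTower.
Context {R : realType} {A : assocAlgType R[i]} {n : nat} (s : 'I_n -> A).
Hypothesis gen : forall a, exists l, formal_eval s l = a.
Local Notation normc := (@ComplexField.Normc.normc R).

(** The quotient seminorm of the weighted l^1 norm on noncommutative polynomials
    under evaluation at the generators. *)
Definition word_norm (k : nat) (a : A) : R :=
  inf [set formal_weight k%:R l | l in [set l | formal_eval s l = a]].

Let weights_has_inf k a : has_inf [set formal_weight k%:R l | l in [set l | formal_eval s l = a]].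
Proof.
split; first by have [l la] := gen a; exists (formal_weight k%:R l); exists l.
by exists 0 => _ [l _ <-]; exact: formal_weight_ge0.
Qed.

Lemma word_norm_le k l : word_norm k (formal_eval s l) <= formal_weight k%:R l.
Proof. by apply: ge_inf; [exact: (weights_has_inf _ _).2|exists l]. Qed.

(** An infimum is bounded below through its members; the factor [c] lets the
    same principle give the triangle inequality, homogeneity, submultiplicativity
    and domination. *)
Lemma le_word_norm k a c r : 0 <= c ->
  (forall l, formal_eval s l = a -> r <= c * formal_weight k%:R l) -> r <= c * word_norm k a.
Proof.
rewrite le_eqVlt => /predU1P[<-|c0] rc.
  by have [l /rc] := gen a; rewrite !mul0r.
rewrite -ler_pdivrMl//; apply: lb_le_inf; first exact: (weights_has_inf _ _).1.
by move=> _ [l la <-]; rewrite ler_pdivrMl// rc.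
Qed.

Lemma word_norm_adherent k a e : 0 < e ->
  exists2 l, formal_eval s l = a & formal_weight k%:R l < word_norm k a + e.
Proof.
by move=> e0; have [_ [l la <-] le] := inf_adherent e0 (weights_has_inf k a); exists l.
Qed.

Lemma word_norm_seminorm k : seminorm (word_norm k).
Proof.
have N0 a : 0 <= word_norm k a.
  by rewrite -[word_norm k a]mul1r; apply: le_word_norm => // l _; rewrite mul1r formal_weight_ge0.
have NZ a x : word_norm k (a *: x) <= normc a * word_norm k x.
  apply: le_word_norm; first exact: normc_ge0.
  by move=> l <-; rewrite -formal_eval_scale -formal_weight_scale word_norm_le.
split=> // [x y|a x].
  rewrite -lerBlDr -[word_norm k x]mul1r; apply: le_word_norm => // l <-.
  rewrite mul1r lerBlDr -lerBlDl -[word_norm k y]mul1r; apply: le_word_norm => // m <-.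
  by rewrite mul1r lerBlDl -formal_eval_cat -formal_weight_cat word_norm_le.
apply/eqP; rewrite eq_le NZ /=; have [->|a0] := eqVneq a 0.
  by rewrite Normc.normc0 mul0r.
have na : 0 < normc a.
  by rewrite lt_neqAle normc_ge0 andbT eq_sym; apply: contra_neq a0; exact: Normc.eq0_normc.
rewrite mulrC -ler_pdivlMr// mulrC -Normc.normcV.
by apply: le_trans (NZ _ _); rewrite scalerA mulVf// scale1r.
Qed.

Lemma word_norm_submult k : submultiplicative (word_norm k).
Proof.
move=> x y; apply: le_word_norm; first exact: seminorm_ge0 (word_norm_seminorm k) x.
move=> m <-; rewrite mulrC; apply: le_word_norm; first exact: formal_weight_ge0.
by move=> l <-; rewrite -formal_eval_mul mulrC -formal_weight_mul word_norm_le.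
Qed.

Lemma word_norm_le_succ k x : word_norm k x <= word_norm k.+1 x.
Proof.
rewrite -[leRHS]mul1r; apply: le_word_norm => // l <-; rewrite mul1r.
apply: le_trans (word_norm_le _ _) _; apply: formal_weight_le => //.
by rewrite ler_nat.
Qed.

Definition word_tower : seminorm_tower A :=
  SeminormTower word_norm_seminorm word_norm_submult word_norm_le_succ.

(** On a word [w], submultiplicativity gives [q (s_w) <= q(1) r^|w|] as soon as
    [r] bounds the values of [q] at the generators, so [q (sum c_w s_w)] is at most
    [q(1)] times the weight of the sum. *)
Lemma word_tower_dominates (q : A -> R) : seminorm q -> submultiplicative q ->
  exists M k, forall a, q a <= M * word_tower k a.
Proof.
move=> sq mq; pose r := \sum_i q (s i).
have [k rk] : exists k, r <= k%:R.
  by exists (Num.truncn r).+1; rewrite ltW// truncnS_gt.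
exists (q aone), k => a; apply: le_word_norm; first exact: seminorm_ge0.
move=> l <-; apply: seminorm_formal_eval => //; apply: submult_word_eval => // i.
apply: le_trans rk; rewrite /r (bigD1 i)//= lerDl.
by apply: sumr_ge0 => j _; exact: seminorm_ge0.
Qed.

End WordTower.

(** * Free entire functions from rapidly decreasing word sums *)

Section FastSequences.
Context {R : realType} {A : assocAlgType R[i]} {P : seminorm_tower A}.

(** The index [h k] exceeds [k] and all the thresholds [N 0, ..., N k], which makes
    the subsequence both cofinal and rapidly Cauchy. *)
Lemma tower_cauchy_fast (u : nat -> A) : tower_cauchy P u ->
  exists2 v, same_limit P u v & forall k, P k (v k.+1 - v k) < 2^-1 ^+ k.+1.
Proof.
move=> cu.
have /choice[N uN] (k : nat) : exists N, forall m n, (N <= m)%N -> (N <= n)%N ->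
    P k (u m - u n) < 2^-1 ^+ k.+1.
  have e0 : 0 < 2^-1 ^+ k.+1 :> R by rewrite exprn_gt0.
  by have [N _ uN] := cu k _ e0; exists N; exact: uN (leqnn N).
pose h k := (k + \sum_(i < k.+1) N i)%N.
have hN k l : (k <= l)%N -> (N k <= h l)%N.
  move=> kl; rewrite /h (bigD1 (Ordinal (kl : (k < l.+1)%N)))//= addnCA leq_addr//.
have le_h k : (k <= h k)%N by rewrite leq_addr.
exists (fun k => u (h k)) => [k e e0|k]; last by apply: uN; apply: hN.
have [M _ uM] := cu k e e0; exists M => // n /= Mn.
exact: (uM M (leqnn M) n (h n) Mn (leq_trans Mn (le_h n))).
Qed.

End FastSequences.

Section ComplexSeries.
Context {R : realType}.
Local Notation normc := (@ComplexField.Normc.normc R).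

(** The real and imaginary parts converge absolutely, being bounded by the
    modulus. *)
Lemma complex_series_cvg (z : nat -> R[i]) (M : R) :
  (forall N, \sum_(0 <= k < N) normc (z k) <= M) ->
  exists l, normc (l - \sum_(0 <= k < N) z k) @[N --> \oo] --> (0 : R).
Proof.
move=> zM.
have cvg_part (f : {additive R[i] -> R}) : (forall c, `|f c| <= normc c) ->
    cvg (\sum_(0 <= k < N) f (z k) @[N --> \oo]).
  move=> f_le; apply: (@normed_cvg _ _ (fun k => f (z k))).
  apply: nondecreasing_is_cvgn; first by apply: nondecreasing_series => k _ _; exact: normr_ge0.
  exists M => _ [N _ <-]; apply: le_trans (zM N).
  by apply: ler_sum => k _; exact: f_le.
have dist0 (g : nat -> R) : cvg (g @ \oo) -> `|limn g - g N| @[N --> \oo] --> (0 : R).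
  move=> cg; rewrite -[0](@normr0 R R) -(subrr (limn g)).
  by apply: cvg_norm; apply: cvgB => //; exact: cvg_cst.
have Re0 := dist0 _ (cvg_part (@complex.Re R) (@Re_le_normc R)).
have Im0 := dist0 _ (cvg_part (@complex.Im R) (@Im_le_normc R)).
exists (limn (fun N => \sum_(0 <= k < N) complex.Re (z k)) +i*
        limn (fun N => \sum_(0 <= k < N) complex.Im (z k)))%C.
have ReIm0 := cvgD (FF := eventually_filter) Re0 Im0; rewrite addr0 in ReIm0.
apply: (squeeze_cvgr _ (cvg_cst (0 : R)) ReIm0); near=> N.
rewrite normc_ge0 /=; apply: le_trans (normc_Re_Im _) _.
by rewrite [X in X <= _]/= !(raddfB, raddf_sum) /= !sumrN.
Unshelve. all: by end_near. Qed.

End ComplexSeries.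

Section FreeEntireOfLists.
Context {R : realType} {n : nat}.
Local Notation normc := (@ComplexField.Normc.normc R).
Local Notation word := (seq 'I_n).
Variable L : nat -> seq (R[i] * word).
Hypothesis L_small : forall k, formal_weight k%:R (L k.+1) <= 2^-1 ^+ k.+1.

(** The partial sums between stages [i] and [j] are represented by concatenated
    lists, so that their coefficients, weights and values are obtained from the
    same lemmas as for a single list. *)
Definition block i j := flatten [seq L k | k <- index_iota i j].

Lemma block_coef i j w : formal_coef (block i j) w = \sum_(i <= k < j) formal_coef (L k) w.
Proof. by rewrite /formal_coef big_flatten big_map. Qed.

Lemma block_weight r i j : formal_weight r (block i j) = \sum_(i <= k < j) formal_weight r (L k).
Proof. by rewrite /formal_weight big_flatten big_map. Qed.

Lemma block_eval (A : assocAlgType R[i]) (s : 'I_n -> A) i j :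
  formal_eval s (block i j) = \sum_(i <= k < j) formal_eval s (L k).
Proof. by rewrite /formal_eval big_flatten big_map. Qed.

Lemma block_cat i j k : (i <= j)%N -> (j <= k)%N -> block i k = block i j ++ block j k.
Proof.
move=> ij jk; rewrite /block -flatten_cat -map_cat /index_iota.
have -> : (k - i = (j - i) + (k - j))%N by rewrite addnC addnBA// subnK.
by rewrite iotaD subnKC.
Qed.

(** For [K < i] each list [L k] with [k >= i] has weight at most [2^-k] for the
    radius [K], because the weight grows with the radius; the geometric series then
    gives the bound. *)
Lemma block_weight_tail (K i j : nat) : (K < i)%N -> formal_weight K%:R (block i j) <= 2 * 2^-1 ^+ i.
Proof.
move=> Ki; have [ji|/ltnW ij] := leqP j i.
  by rewrite block_weight big_geq// mulr_ge0// exprn_ge0.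
(* Adding the remainder [2 * 2^-j] of the geometric series makes the bound stable
   under induction on [j]. *)
suff : formal_weight K%:R (block i j) + 2 * 2^-1 ^+ j <= 2 * 2^-1 ^+ i.
  by apply: le_trans; rewrite lerDl mulr_ge0// exprn_ge0.
rewrite block_weight; elim: j ij => [|j IH].
  by rewrite leqn0 => /eqP i0; rewrite i0 in Ki.
rewrite leq_eqVlt => /predU1P[->|]; first by rewrite big_geq// add0r.
rewrite ltnS => ij; rewrite big_nat_recr//=; apply: le_trans (IH ij).
rewrite -addrA lerD2l exprS mulrA divff// mul1r.
rewrite mulr_natl mulr2n lerD2r.
case: j ij {IH} => [|j ij]; first by rewrite leqn0 => /eqP i0; rewrite i0 in Ki.
apply: le_trans (L_small j); apply: formal_weight_le => //.
by rewrite ler_nat -ltnS (leq_trans Ki).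
Qed.

(** A single coefficient is bounded by the weight for the radius 1, so the
    series of coefficients of a fixed word converges absolutely.  The tail estimate
    for the radius 1 holds from stage 2 on, whence the separate initial block. *)
Lemma coef_limit_ex : exists f : word -> R[i],
  forall w, normc (f w - formal_coef (block 0 N) w) @[N --> \oo] --> (0 : R).
Proof.
suff /choice[f fP] (w : word) : exists l, normc (l - formal_coef (block 0 N) w) @[N --> \oo] --> (0 : R).
  by exists f.
have [|l lP] := @complex_series_cvg _ (fun k => formal_coef (L k) w)
  (formal_weight 1 (block 0 2) + 2 * 2^-1 ^+ 2).
  move=> N; apply: (@le_trans _ _ (formal_weight 1 (block 0 N))).
    rewrite block_weight; apply: ler_sum => k _.
    have := @sum_normc_formal_coef R n 1 (L k) [:: w] ler01 isT.
    by rewrite big_seq1 expr1n mulr1.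
  have tail0 : 0 <= 2 * 2^-1 ^+ 2 :> R by rewrite mulr_ge0// exprn_ge0.
  have [N2|N2] := leqP N 2.
    apply: (@le_trans _ _ (formal_weight 1 (block 0 2))); last by rewrite lerDl.
    by rewrite (@block_cat 0 N 2)// formal_weight_cat lerDl formal_weight_ge0.
  rewrite (@block_cat 0 2 N)// ?(ltnW N2)// formal_weight_cat lerD2l.
  exact: (@block_weight_tail 1).
exists l; under eq_fun do rewrite block_coef; exact: lP.
Qed.

Definition coef_limit : word -> R[i] := sval (cid coef_limit_ex).

Lemma coef_limitP w : normc (coef_limit w - formal_coef (block 0 N) w) @[N --> \oo] --> (0 : R).
Proof. exact: (svalP (cid coef_limit_ex)). Qed.

(** The bound does not depend on the finite set of words [D]: it holds for the
    difference of two partial sums by [block_weight_tail], and for finite [D] it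
    survives the passage to the limit in each coefficient. *)
Lemma coef_limit_tail (K i : nat) (D : seq word) : uniq D -> (K < i)%N ->
  \sum_(w <- D) normc (coef_limit w - formal_coef (block 0 i) w) * K%:R ^+ size w
    <= 2 * 2^-1 ^+ i.
Proof.
move=> uD Ki.
have lim0 : \sum_(w <- D) normc (coef_limit w - formal_coef (block 0 N) w) * K%:R ^+ size w
    @[N --> \oo] --> (0 : R).
  elim: D {uD} => [|w D IH]; first by under eq_fun do rewrite big_nil; exact: cvg_cst.
  have := cvgD (FF := eventually_filter) (cvgMr_tmp (b := K%:R ^+ size w) (coef_limitP w)) IH.
  rewrite mul0r addr0 => wD0.
  under eq_fun do rewrite big_cons; exact: wD0.
have cvg_bound : 2 * 2^-1 ^+ i + \sum_(w <- D)
      normc (coef_limit w - formal_coef (block 0 N) w) * K%:R ^+ size w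
    @[N --> \oo] --> (2 * 2^-1 ^+ i + 0 : R).
  by apply: cvgD => //; exact: cvg_cst.
rewrite -[leRHS]addr0; apply: (cvgr_to_ge cvg_bound); exists i => // N /= iN.
rewrite addrC; apply: (@le_trans _ _ (\sum_(w <- D)
  (normc (coef_limit w - formal_coef (block 0 N) w) * K%:R ^+ size w +
   normc (formal_coef (block i N) w) * K%:R ^+ size w))).
  apply: ler_sum => w _; rewrite -mulrDl ler_wpM2r ?exprn_ge0//.
  apply: le_trans (ler_normcD _ _); rewrite !block_coef.
  by rewrite [X in _ - X + _](@big_cat_nat _ _ _ i 0 N)//= opprD addrA subrK.
rewrite big_split/= lerD2l.
apply: le_trans (sum_normc_formal_coef _ _ uD) (block_weight_tail _ Ki); exact: ler0n.
Qed.

Lemma coef_limit_summable (rho : R) : 0 < rho ->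
  (\esum_(w in [set: word]) (normc (coef_limit w) * rho ^+ size w)%:E < +oo)%E.
Proof.
move=> rho0; have [K rhoK] : exists K : nat, rho <= K%:R.
  by exists (Num.truncn rho).+1; rewrite ltW// truncnS_gt.
pose M : R := 2 * 2^-1 ^+ K.+1 + formal_weight K%:R (block 0 K.+1).
apply: (@le_lt_trans _ _ M%:E); last exact: ltry.
apply: ge_ereal_sup => _ [D [finD _] <-].
rewrite fsbig_finite//= sumEFin lee_fin.
have uD := fset_uniq (fset_set D).
apply: le_trans (lerD (coef_limit_tail uD (ltnSn K)) (sum_normc_formal_coef (block 0 K.+1) (ler0n R K) uD)).
rewrite -big_split; apply: ler_sum => w _ /=; rewrite -mulrDl.
apply: ler_pM; rewrite ?normc_ge0 ?exprn_ge0 ?(ltW rho0)//.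
  by rewrite -[X in normc X <= _](subrK (formal_coef (block 0 K.+1) w)) ler_normcD.
by rewrite lerXn2r ?nnegrE// ltW.
Qed.

Definition free_entire_of_lists : free_entire n := FreeEntire coef_limit_summable.

End FreeEntireOfLists.

(** * Limits as values of free entire functions *)

Section FreeEvaluation.
Context {R : realType} {A : assocAlgType R[i]} {n : nat} (s : 'I_n -> A).
Hypothesis gen : forall a, exists l, formal_eval s l = a.
Context {E : topAlgType R[i]} {Q : set (E -> R)}.
Hypotheses (sQ : forall q, Q q -> seminorm q) (topQ : defines_topology Q).
Hypothesis hausE : hausdorff_space E.
Context {phi : A -> E} (phi_hom : alg_hom phi).
Local Notation P := (word_tower gen).
Hypothesis phi_dom : forall q, Q q -> exists M k, forall a, q (phi a) <= M * P k a.
Local Notation normc := (@ComplexField.Normc.normc R).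

Lemma alg_hom_word_eval w : phi (word_eval s w) = word_eval (phi \o s) w.
Proof. by case: phi_hom => _ phi1 phiM; elim: w => //= i w IH; rewrite phiM IH. Qed.

Lemma alg_hom_formal_eval l : phi (formal_eval s l) = formal_eval (phi \o s) l.
Proof.
rewrite /formal_eval; elim: l => [|t l IH]; first by rewrite !big_nil (alg_hom0 phi_hom).
by rewrite !big_cons (alg_homD phi_hom) (alg_homZ phi_hom) IH alg_hom_word_eval.
Qed.

(** Take a rapidly Cauchy [v] with the same limit as [u] and write its first term
    and its successive differences as word sums [L k] of small weight.  The stage
    [N] partial sums evaluate to [v N] exactly, and over any finite set of words
    containing those of this stage, the limit coefficients differ from the partial
    ones by a total of at most [2 * 2^-(N+1)] in weight.  Hence the unordered sum
    of the limit series at the images of the generators is the limit of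
    [phi (v N)]. *)
Lemma free_eval_limit (u : nat -> A) (y : E) : tower_cauchy P u ->
  phi (u k) @[k --> \oo] --> y -> exists f : free_entire n, free_eval f (phi \o s) = y.
Proof.
move=> cu uy; have [v uv v_fast] := tower_cauchy_fast cu.
have vy : phi (v k) @[k --> \oo] --> y.
  have vu0 := null_cvg0 topQ phi_dom (same_limit_sym uv).
  rewrite -[y]add0r (_ : (fun k => _) = (fun k => phi (v k - u k) + phi (u k))); last first.
    by apply/funext => k; rewrite -(alg_homD phi_hom) subrK.
  exact: tlmod_cvgD vu0 uy.
have [l0 l0v] := gen (v 0%N).
have /choice[l lP] (k : nat) : exists l, formal_eval s l = v k.+1 - v k /\
    formal_weight k%:R l <= 2^-1 ^+ k.+1.
  have e0 : 0 < 2^-1 ^+ k.+1 - P k (v k.+1 - v k) by rewrite subr_gt0.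
  have [l lv lw] := word_norm_adherent gen k (v k.+1 - v k) e0.
  by exists l; split=> //; apply: ltW; rewrite addrC subrK in lw.
pose L k := if k is k'.+1 then l k' else l0.
have L_small k : formal_weight k%:R (L k.+1) <= 2^-1 ^+ k.+1 by have [] := lP k.
have L_eval N : formal_eval s (block L 0 N.+1) = v N.
  rewrite block_eval; elim: N => [|N IH]; first by rewrite big_nat1.
  by rewrite big_nat_recr//= IH (lP N).1 addrC subrK.
pose f := free_entire_of_lists L_small; exists f.
have totF : ProperFilter (@summability.totally (seq 'I_n)) := summability.totally_filter.
have fy : summability.partial_sum (fun w => f w *: word_eval (phi \o s) w)
    @ summability.totally --> y.
  apply: (cvg_seminorms topQ _ _).2 => q Qq e e0.
  have sq := sQ Qq; have e20 := divr_gt0 e0 (ltr0Sn R 1).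
  have [M [K [M0 qM]]] := dominated_pos phi_dom Qq.
  have q_word w : q (word_eval (phi \o s) w) <= M * K%:R ^+ size w.
    rewrite -alg_hom_word_eval; apply: le_trans (qM _) _; rewrite ler_pM2l//.
    have := word_norm_le gen K [:: (1, w)].
    by rewrite /formal_eval /formal_weight !big_seq1 scale1r Normc.normc1 mul1r.
  have [N [KN vN tailN]] : exists N, [/\ (K <= N)%N, q (phi (v N) - y) < e / 2
      & M * (2 * 2^-1 ^+ N.+1) < e / 2].
    have near_v : \forall k \near \oo, q (phi (v k) - y) < e / 2.
      exact: (cvg_seminorms topQ _ _).1 vy q Qq _ e20.
    have tail0 : M * (2 * 2^-1 ^+ N.+1) @[N --> \oo] --> (0 : R).
      under eq_fun do rewrite exprS mulrA divff// mul1r.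
      by rewrite -[0](mulr0 M); apply: cvgMl_tmp; apply: cvg_expr; rewrite ger0_norm// invf_lt1// ltr1n.
    have [N [[KN vN] tN]] := filter_ex (FF := eventually_filter)
      (filterI (filterI (nbhs_infty_ge K) near_v) (cvgr_lt _ tail0 _ e20)).
    by exists N.
  (* Once [D] contains the words up to stage [N], both sums run over [D] and can be
     compared coefficient by coefficient. *)
  exists [fset w in [seq t.2 | t <- block L 0 N.+1]]%fset => // D /= /fsubsetP LD.
  rewrite /summability.partial_sum.
  rewrite -(big_seq_fsetE _ _ predT (fun w => f w *: word_eval (phi \o s) w)) /=.
  have uD := fset_uniq D.
  have LD' : {subset [seq t.2 | t <- block L 0 N.+1] <= (D : seq _)}.
    by move=> w wL; apply: LD; rewrite !inE.
  have := sum_formal_coef (phi \o s) uD LD'; rewrite -alg_hom_formal_eval L_eval => vNE.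
  rewrite (splitr e); apply: (le_lt_trans (seminormB_trans sq (phi (v N)) _ _)).
  apply: ltrD => //; apply: le_lt_trans tailN; rewrite -vNE -sumrB.
  apply: (le_trans (seminorm_sum sq _ _ _)).
  apply: (@le_trans _ _ (M * \sum_(w <- D)
      normc (f w - formal_coef (block L 0 N.+1) w) * K%:R ^+ size w)).
    rewrite mulr_sumr; apply: ler_sum => w _.
    by rewrite -scalerBl (seminormZ sq) mulrCA ler_wpM2l ?normc_ge0.
  by rewrite ler_pM2l//; apply: coef_limit_tail.
apply: xget_unique => //= z fz; exact: (cvg_unique hausE fz fy).
Qed.

End FreeEvaluation.

Lemma generating_family (R : realType) (A : assocAlgType R[i]) : finitely_generated A ->
  exists n (s : 'I_n -> A), forall a, exists l, formal_eval s l = a.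
Proof.
move=> [S /finite_seqP[r ->] gen]; exists (size r), (tnth (in_tuple r)).
apply: finitely_generated_formal; rewrite -gen; congr (smallest _ _).
apply/seteqP; split=> [_ [i _ <-]|a ra]; first exact: (mem_tnth i (in_tuple r)).
by have /tnthP[i ->] : a \in in_tuple r by []; exists i.
Qed.

(** * The envelope as a retract of the completion *)

Section EnvelopeRetract.
Context {R : realType} {A : assocAlgType R[i]} {P : seminorm_tower A}.
Context {E : topAlgType R[i]} {Q : set (E -> R)}.
Hypotheses (sQ : forall q, Q q -> seminorm q) (topQ : defines_topology Q).
Hypothesis complE : complete_space E.
Context {phi : A -> E} (phi_hom : alg_hom phi).
Hypothesis phi_dom : forall q, Q q -> exists M k, forall a, q (phi a) <= M * P k a.
Local Notation theta := (extension topQ complE phi_hom phi_dom).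

(** The two universal properties play against each other: [psi] comes from that
    of the envelope, and the composite of [psi] with the extension of [phi]
    agrees with the identity on the image of [phi], so that the uniqueness
    clause for [phi] itself makes it the identity. *)
Lemma envelope_section : arens_michael_envelope phi ->
  exists psi : E -> completion P,
    [/\ continuous psi, alg_hom psi & forall x, theta (psi x) = x].
Proof.
move=> [am _ univ]; have [_ hausE _] := am.
have [psi [[psi_cont psi_hom psi_phi] _]] :=
  univ _ _ (@completion_arens_michael _ _ P) (embed_alg_hom P).
exists psi; split=> // x.
have [id' [_ id'_unique]] := univ E phi am phi_hom.
have idE : id' = id by apply: id'_unique; split=> // y; exact: cvg_id.
suff compE : id' = theta \o psi by rewrite -[LHS]/((theta \o psi) x) -compE idE.
apply: id'_unique; split.
- move=> y; apply: continuous_comp; first exact: psi_cont.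
  exact: extension_continuous.
- apply: (alg_hom_comp psi_hom); exact: extension_alg_hom.
- by rewrite -compA psi_phi; apply/funext => a /=; exact: extension_embed.
Qed.

(** A retract inherits a countable family of seminorms: those of the completion,
    pulled back along [psi], are continuous because [psi] is, and they dominate
    [Q] because every point is [theta] of its image under [psi]. *)
Lemma retract_countable_seminorms (psi : E -> completion P) :
  continuous psi -> alg_hom psi -> (forall x, theta (psi x) = x) ->
  exists p : nat -> E -> R, (forall k, seminorm (p k)) /\ defines_topology (range p).
Proof.
move=> psi_cont psi_hom psiK; pose p k := @completion_norm _ _ P k \o psi.
have sp k : seminorm (p k) := seminorm_comp psi_hom (completion_seminorm P k).
exists p; split=> //; apply: increasing_defines_topology => // [k e x e0|x U].
  have psi_near : \forall y \near x, completion_norm k (psi y - psi x) < e.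
    exact: psi_cont (nbhs_completion_norm (psi x) k e0).
  by apply: filterS psi_near => y; rewrite /p /= (alg_homB psi_hom).
move=> /topQ[F [e [finF FQ e0 FU]]].
have [|||k kF] := @finite_dominated R E p F _ _ finF.
- by move=> k y; exact: (seminorm_ge0 (sp k)).
- by move=> k l y; exact: completion_norm_mono.
- move=> q /FQ Qq; have [M [k qM]] := phi_dom Qq; exists M, k => y.
  by rewrite -[y in q y]psiK; exact: extension_dom.
exists k, (e / k.+1%:R) => [|y /= yx]; first exact: divr_gt0.
apply: FU => q /kF/(_ (y - x)) qk; apply: le_lt_trans qk _.
by rewrite mulrC -ltr_pdivlMr.
Qed.

End EnvelopeRetract.

Theorem corollary3p5 (R : realType) (A : assocAlgType R[i])
    (Ahat : topAlgType R[i]) (iA : A -> Ahat)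
    (hA : finitely_generated A) (hAhat : arens_michael_envelope iA) :
  HFG Ahat.
Proof.
have [n [s gen]] := generating_family hA.
have [am iA_hom _] := hAhat; have [[Q [semiQ topQ]] hausA complA] := am.
have sQ q : Q q -> seminorm q by move=> /semiQ[].
have iA_dom q : Q q -> exists M k, forall a, q (iA a) <= M * word_tower gen k a.
  move=> /semiQ[sq mq].
  exact: word_tower_dominates (seminorm_comp iA_hom sq) (submultiplicative_comp iA_hom mq).
have [psi [psi_cont psi_hom psiK]] := envelope_section sQ topQ complA iA_hom iA_dom hAhat.
split.
  by split=> //; split=> //; exact: retract_countable_seminorms psi_cont psi_hom psiK.
exists (range (iA \o s)); first exact: finite_image.
apply/seteqP; split=> // x _ B [[_ hol] SB].
have lim_x : iA (rep (psi x) k) @[k --> \oo] --> x.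
  by rewrite -[X in _ --> X]psiK; exact: extension_cvg (repP (psi x)).
have [f <-] := free_eval_limit sQ topQ hausA iA_hom iA_dom
  (representative_cauchy (repP (psi x))) lim_x.
by apply: hol => i; apply: SB; exists i.
Qed.
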